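(* For all $c,C>0$ there exist $c',n_0>0$ such that the following holds. Let $n>n_0$ and let $G$ be an $n$-graded compact group that is $(cn^{1/2},C)$-hypercontractive and $c$-strongly-quasirandom. Then every measurable product-free subset of $G$ has Haar measure at most $e^{-c' n^{1/3}}$.
   Context: An $n$-graded compact group is a compact connected group $G$ together with an orthogonal decomposition $L^2(G)=\bigoplus_{d=0}^{\lceil n/2\rceil-1}V_{=d}\oplus V_{\ge n/2}$ into closed subspaces invariant under left and right translations, with $V_{=0}$ the constants ($L^2$ taken with respect to Haar probability measure); $f^{=d}$ denotes orthogonal projection onto $V_{=d}$. For $r<n/2$ and $0\le\delta\le1$, $T_{\delta,r}f=\sum_{0\le i\le r,\ i\in\mathbb{Z}}\delta^if^{=i}$. $G$ is $(r,C)$-hypercontractive if $\|T_{\delta,r}f\|_q\le\|f\|_2$ for all $q\ge2$, $0\le\delta\le 1/(C\sqrt q)$ and $f\in L^2(G)$. $G$ is $c$-strongly-quasirandom if every nonzero closed left-invariant subrepresentation of $V_{=d}$ ($1\le d<n/2$) has dimension at least $Q_d$ and every such subrepresentation of $V_{\ge n/2}$ has dimension at least $Q$, where $Q_d=(cn/d)^d$ for $d<cn/(1+c)$ and $Q_d=Q=(1+c)^{cn/(1+c)}$ for $d\ge cn/(1+c)$. A set is product-free if it contains no $g,h$ with $gh$ in it. *)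

(* Defs.v *)
From HB Require Import structures.
From mathcomp Require Import all_boot all_order all_algebra.
From mathcomp Require Import all_classical all_reals all_analysis.
From mathcomp Require Import complex.

Set Implicit Arguments.
Unset Strict Implicit.
Unset Printing Implicit Defensive.

Import Order.TTheory GRing.Theory Num.Theory.
Import numFieldNormedType.Exports.

Local Open Scope classical_set_scope.
Local Open Scope ring_scope.
Local Open Scope complex_scope.

(** Topological groups, in multiplicative notation.  A group is nonempty, so
    asking for a [pointedType] is no restriction; the library needs the point
    in order to put the Borel sigma-algebra on the type. *)
HB.mixin Record isTopologicalGroup G & PointedTopological G & Group G := {
  mulg_continuous : continuous (fun x : G * G => (x.1 * x.2)%g) ;
  invg_continuous : continuous (fun x : G => (x^-1)%g) ;
}.

#[short(type="topologicalGroupType")]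
HB.structure Definition TopologicalGroup :=
  {G of PointedTopological G & Group G & isTopologicalGroup G}.

(** Complex-valued [L^2].  Its elements are represented by functions; all the
    notions below are insensitive to replacing a function by a measurable
    function that is a.e. equal to it. *)
Section ComplexL2.
Context {d} {T : measurableType d} {R : realType}.
Variable mu : {measure set T -> \bar R}.
Local Notation C := R[i].
Implicit Types (f g : T -> C) (V : set (T -> C)).

(** The modulus [`|z|] of [z : R[i]] lives in [R[i]], hence the real part. *)
Definition cLnorm (p : \bar R) f : \bar R :=
  Lnorm mu p (fun x => (complex.Re `|f x|)%:E).

Definition L2 : set (T -> C) := [set f |
  [/\ measurable_fun setT (fun x => complex.Re (f x)),
      measurable_fun setT (fun x => complex.Im (f x)) &
      (cLnorm 2%:E f < +oo)%E]].

Definition cintegral f : C :=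
  (\int[mu]_x complex.Re (f x)) +i* (\int[mu]_x complex.Im (f x)).

Definition cinner f g : C := cintegral (fun x => f x * (g x)^*).

Definition orthogonal V V' := forall f g, V f -> V' g -> cinner f g = 0.

(** Sequential closedness in the [L^2] norm.  Applied to constant sequences it
    also says that [V] is a union of classes modulo a.e. equality. *)
Definition L2_closed V := forall (u : nat -> T -> C) f,
  (forall k, V (u k)) -> L2 f ->
  cLnorm 2%:E (fun x => u k x - f x) @[k --> \oo] --> 0%E -> V f.

Definition closed_subspace V :=
  [/\ V `<=` L2,
      V (fun=> 0),
      (forall (a : C) f g, V f -> V g -> V (fun x => a * f x + g x)) &
      L2_closed V].

Definition constants : set (T -> C) := [set f |
  L2 f /\ exists a : C, {ae mu, forall x, f x = a}].

Definition nonzero V := exists2 f, V f & ~ {ae mu, forall x, f x = 0}.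

Definition lin_indep k (b : 'I_k -> T -> C) := forall a : 'I_k -> C,
  {ae mu, forall x, \sum_(i < k) a i * b i x = 0} -> forall i, a i = 0.

(** Complex dimension, [+oo] for an infinite-dimensional [V]. *)
Definition dimension V : \bar R := ereal_sup [set (k%:R)%:E | k in
  [set k : nat | exists2 b : 'I_k -> T -> C,
     (forall i, V (b i)) & lin_indep b]].

(** A representative of the orthogonal projection; for [f] in [L^2] and [V] a
    closed subspace it exists and is unique up to a null set. *)
Definition proj V f : T -> C := xget (fun=> 0) [set g |
  V g /\ forall h, V h -> cinner (fun x => f x - g x) h = 0].

End ComplexL2.

Notation borel G := (g_sigma_algebraType (@open G)).

Section GradedGroups.
Context {R : realType} {G : topologicalGroupType}.
Variable mu : probability (borel G) R.
Local Notation C := R[i].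

(** [mu] is the Haar probability measure of the compact group [G]: the
    left-invariant Borel probability measure that is regular (regularity is
    automatic only when [G] is second countable). *)
Definition haar :=
  [/\ (forall (g : G) (A : set (borel G)), measurable A ->
         mu [set x : G | A (g * x)%g] = mu A),
      (forall A : set (borel G), measurable A ->
         mu A = ereal_inf [set mu U | U in
                  [set U : set G | open U /\ A `<=` U]]) &
      (forall U : set G, open U ->
         mu U = ereal_sup [set mu K | K in
                  [set K : set G | compact K /\ K `<=` U]])].

Definition left_invariant (V : set (borel G -> C)) :=
  forall (g : G) f, V f -> V (fun x => f (g * x)%g).

Definition right_invariant (V : set (borel G -> C)) :=
  forall (g : G) f, V f -> V (fun x => f (x * g)%g).

(** [level d] is V_{=d} for 0 <= d <= ceil(n/2) - 1, and [high] is V_{>= n/2};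
    [uphalf n] is ceil(n/2), so [d < uphalf n] iff d < n/2. *)
Record grading (n : nat) := Grading {
  level : 'I_(uphalf n) -> set (borel G -> C) ;
  high : set (borel G -> C) ;
  level_closed : forall d, closed_subspace mu (level d) ;
  high_closed : closed_subspace mu high ;
  level_left : forall d, left_invariant (level d) ;
  level_right : forall d, right_invariant (level d) ;
  high_left : left_invariant high ;
  high_right : right_invariant high ;
  level_orth : forall d e, d != e -> orthogonal mu (level d) (level e) ;
  level_high_orth : forall d, orthogonal mu (level d) high ;
  grading_sum : forall f, L2 mu f ->
    exists (fl : 'I_(uphalf n) -> borel G -> C) (fh : borel G -> C),
      [/\ (forall d, level d (fl d)), high fh &
          {ae mu, forall x, f x = \sum_(d < uphalf n) fl d x + fh x}] ;
  level0 : forall d : 'I_(uphalf n), d = 0%N :> nat ->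
    level d = constants mu
}.

(** T_{delta,r}; here [delta ^+ 0 = 1], also for [delta = 0]. *)
Definition noise n (V : grading n) (delta r : R) (f : borel G -> C) :
    borel G -> C :=
  fun x => \sum_(i < uphalf n | i%:R <= r)
    (delta ^+ i)%:C * proj mu (level V i) f x.

Definition hypercontractive n (V : grading n) (r K : R) :=
  forall q delta : R, 2 <= q -> 0 <= delta <= 1 ->
    delta <= 1 / (K * Num.sqrt q) ->
  forall f, L2 mu f ->
    (cLnorm mu q%:E (noise V delta r f) <= cLnorm mu 2%:E f)%E.

Definition Qtop (c : R) (n : nat) : R := (1 + c) `^ (c * n%:R / (1 + c)).

Definition Qlevel (c : R) (n d : nat) : R :=
  if d%:R < c * n%:R / (1 + c) then (c * n%:R / d%:R) ^+ d else Qtop c n.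

Definition subreps_dim_ge (V : set (borel G -> C)) (Q : R) :=
  forall U : set (borel G -> C),
    closed_subspace mu U -> left_invariant U -> U `<=` V -> nonzero mu U ->
    (Q%:E <= dimension mu U)%E.

Definition strongly_quasirandom n (V : grading n) (c : R) :=
  (forall d : 'I_(uphalf n), (0 < d)%N ->
     subreps_dim_ge (level V d) (Qlevel c n d)) /\
  subreps_dim_ge (high V) (Qtop c n).

End GradedGroups.

Definition product_free {G : groupType} (A : set G) :=
  forall g h : G, A g -> A h -> ~ A (g * h)%g.

(* Main.v *)
Require Import Defs.
From mathcomp Require Import all_boot all_order all_algebra.
From mathcomp Require Import all_classical all_reals all_analysis.
From mathcomp Require Import complex measurable_realfun zify ring lra.
Import Order.TTheory GRing.Theory Num.Theory.
Import numFieldNormedType.Exports.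
Local Open Scope classical_set_scope.
Local Open Scope ring_scope.
Set Implicit Arguments.
Unset Strict Implicit.
Unset Printing Implicit Defensive.

(** Let [alpha] be the measure of [A], let [S_g v (x) = <L_x v, g>] with
    [L_x v (y) = v (x y)], and split the indicator [f] of [A] into its
    components [f_d].  If [A] is product-free then [<S_f f, f> = 0].  Left
    invariance kills the terms [<L_x f_d, f_e>] with [d <> e], and right
    invariance then leaves [0 = \sum_d <S_(f_d) f_d, f_d>], where the constant
    component contributes [alpha ^ 3].

    If every left-invariant subspace of [V] has dimension at least [Q] and [f]
    is in [V], then [|S_f f|^2 <= |f|^4 / Q].  Indeed, [S = S_f] commutes with
    left translations, so the eigenspaces of [S^* S] in [V] are left-invariant;
    [k] orthonormal eigenfunctions [e_i] for the eigenvalue [lam] satisfy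
    [k lam = \sum_i |S e_i|^2 <= |f|^2] by Bessel's inequality at each [x],
    whence [lam <= |f|^2 / Q].  A large eigenvalue is produced by power
    iteration: the moments [a_k = <(S^* S)^k f, f>] are log-convex and
    [a_(2m+1) <= a_m^2], hence [a_k >= lam ^ (k+1)] and [a_1 <= lam a_0] for
    [lam] the limit of their ratios, and [(S^* S)^k f / lam^k] converges to a
    nonzero eigenfunction for [lam].

    Put [L = c' n^(1/3)] and suppose [alpha > e^-L].  For [d <= L / 2],
    hypercontractivity with [q = L / d] gives [|f_d| <= alpha (K sqrt(L/d))^d],
    which makes the low levels contribute at most [alpha^3 / 3]; for [d > L / 2]
    and for the high part [Q_d >= e^(4 L)], so these contribute at most
    [alpha^3 / 2].  This contradicts the vanishing of the sum. *)

(** * Complex-valued [L^2] *)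

Section ComplexModulus.
Context {R : realType}.
Local Notation Re := complex.Re.
Local Notation Im := complex.Im.
Local Open Scope complex_scope.
Local Notation "z ^*" := (Num.conj z) : complex_scope.
Implicit Types z w : R[i].

(** When [G] is not second countable, the Borel sets of [G * G] may go beyond the product
    sigma-algebra, so Fubini's theorem cannot be applied to [v (x * y)] directly. The exchange of
    integrals is instead carried by [fubini_kernel]: rank-one kernels have it, it survives linear
    combinations and limits that are uniform over all rows and all columns, hence it reaches
    continuous kernels by compactness and [v (x * y)] by density of continuous functions. The same
    exchange turns left invariance of [mu], the only invariance in [haar], into invariance under
    inversion and right translations.

    Elements of [L2] are functions, so most identities hold only a.e.; they are stated through inner
    products or as [nrm _ = 0].

    The exponent 1/3 comes from the low levels. With [B = e * max(K, 1)], the term of level [d] is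
    at most [alpha^3 (B sqrt(L/d))^(3d) / (c n/d)^(d/2)]. For this to be at most [alpha^3 4^-d] one
    asks [16 B^6 (L/d)^3 <= c n/d], which at [d = 1] bounds [L^3] by a multiple of [n]. *)

Definition cmod z : R := Re `|z|.

Lemma cmodE z : cmod z = Num.sqrt (Re z ^+ 2 + Im z ^+ 2).
Proof. by rewrite /cmod normc_def. Qed.

Lemma cmodC z : (cmod z)%:C = `|z|.
Proof. by rewrite cmodE normc_def. Qed.

Lemma cmod_ge0 z : 0 <= cmod z.
Proof. by rewrite cmodE sqrtr_ge0. Qed.

Lemma cmod_sqr z : cmod z ^+ 2 = Re z ^+ 2 + Im z ^+ 2.
Proof. by rewrite cmodE sqr_sqrtr// addr_ge0// sqr_ge0. Qed.

Lemma cmodM z w : cmod (z * w) = cmod z * cmod w.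
Proof. by apply: complexI; rewrite cmodC normrM -!cmodC -rmorphM. Qed.

Lemma cmodD z w : cmod (z + w) <= cmod z + cmod w.
Proof. by rewrite -lecR rmorphD /= !cmodC ler_normD. Qed.

Lemma cmodN z : cmod (- z) = cmod z.
Proof. by apply: complexI; rewrite !cmodC normrN. Qed.

Lemma cmodJ z : cmod z^* = cmod z.
Proof. by apply: complexI; rewrite !cmodC normcJ. Qed.

Lemma cmod0 : cmod 0 = 0.
Proof. by apply: complexI; rewrite cmodC normr0. Qed.

Lemma cmodr (x : R) : cmod x%:C = `|x|.
Proof. by rewrite cmodE /= expr0n addr0 sqrtr_sqr. Qed.

Lemma cmod_eq0 z : cmod z = 0 -> z = 0.
Proof. by move=> h; apply/eqP; rewrite -normr_eq0 -cmodC h. Qed.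

Lemma cmod_Re z : `|Re z| <= cmod z.
Proof. by rewrite -lecR cmodC normc_ge_Re. Qed.

Lemma cmod_Im z : `|Im z| <= cmod z.
Proof.
by rewrite cmodE -sqrtr_sqr ler_wsqrtr// lerDr sqr_ge0.
Qed.

Lemma ReD z w : Re (z + w) = Re z + Re w. Proof. by case: z; case: w. Qed.
Lemma ImD z w : Im (z + w) = Im z + Im w. Proof. by case: z; case: w. Qed.
Lemma ReN z : Re (- z) = - Re z. Proof. by case: z. Qed.
Lemma ImN z : Im (- z) = - Im z. Proof. by case: z. Qed.
Lemma ReJ z : Re z^* = Re z. Proof. by case: z. Qed.
Lemma ImJ z : Im z^* = - Im z. Proof. by case: z. Qed.
Lemma ReM z w : Re (z * w) = Re z * Re w - Im z * Im w.
Proof. by case: z; case: w. Qed.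
Lemma ImM z w : Im (z * w) = Re z * Im w + Im z * Re w.
Proof. by case: z; case: w. Qed.
Definition ReImE := (ReD, ImD, ReN, ImN, ReJ, ImJ, ReM, ImM).

Lemma complex_ext z w : Re z = Re w -> Im z = Im w -> z = w.
Proof. by case: z w => [a b] [c d] /= -> ->. Qed.

Lemma mulJ_sqr z : z * z^* = (cmod z ^+ 2)%:C.
Proof.
by rewrite cmod_sqr; apply: complex_ext; rewrite !ReImE /=; ring.
Qed.

Lemma conjMc z w : (z * w)^* = z^* * w^*. Proof. exact: rmorphM. Qed.
Lemma conjDc z w : (z + w)^* = z^* + w^*. Proof. exact: rmorphD. Qed.

End ComplexModulus.

Section L2Basics.
Context {d} {T : measurableType d} {R : realType} (mu : probability T R).
Local Notation Re := complex.Re.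
Local Notation Im := complex.Im.
Local Open Scope complex_scope.
Local Notation "z ^*" := (Num.conj z) : complex_scope.
Implicit Types f g h : T -> R[i].

Lemma integrableRZ (b : R) (u : T -> R) :
  mu.-integrable setT (EFin \o u) ->
  mu.-integrable setT (EFin \o (fun x => b * u x)).
Proof. by move=> iu; have := integrableZl measurableT b iu. Qed.

Lemma integrableRD (u v : T -> R) : mu.-integrable setT (EFin \o u) ->
  mu.-integrable setT (EFin \o v) ->
  mu.-integrable setT (EFin \o (fun x => u x + v x)).
Proof. by move=> iu iv; have := integrableD measurableT iu iv. Qed.

Definition cmeas f :=
  measurable_fun setT (fun x => Re (f x)) /\
  measurable_fun setT (fun x => Im (f x)).

Lemma cmeas_lin (a : R[i]) f g : cmeas f -> cmeas g ->
  cmeas (fun x => a * f x + g x).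
Proof.
move=> [f1 f2] [g1 g2]; split; under eq_fun do rewrite !ReImE.
  apply: measurable_funD => //; apply: measurable_funB; exact: measurable_funM.
apply: measurable_funD => //; by apply: measurable_funD; exact: measurable_funM.
Qed.

Lemma cmeasM f g : cmeas f -> cmeas g -> cmeas (fun x => f x * g x).
Proof.
move=> [f1 f2] [g1 g2]; split; under eq_fun do rewrite !ReImE.
  apply: measurable_funB; exact: measurable_funM.
by apply: measurable_funD; exact: measurable_funM.
Qed.

Lemma cmeas_cst (a : R[i]) : cmeas (fun=> a).
Proof. by split; exact: measurable_cst. Qed.

Lemma cmeasJ f : cmeas f -> cmeas (fun x => (f x)^*).
Proof.
move=> [f1 f2]; split; first by under eq_fun do rewrite ReJ.
by under eq_fun do rewrite ImJ; exact: measurable_funN.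
Qed.

Lemma cmeas_cmod f : cmeas f -> measurable_fun setT (fun x => cmod (f x)).
Proof.
move=> [f1 f2]; under eq_fun do rewrite cmodE.
apply: (measurableT_comp (continuous_measurable_fun (@sqrt_continuous R))).
apply: measurable_funD; exact: measurable_funX.
Qed.

Lemma cLnorm2E f : cLnorm mu 2%:E f =
  ((\int[mu]_x ((cmod (f x)) ^+ 2)%:E) `^ 2^-1)%E.
Proof.
rewrite /cLnorm unlock; congr (_ `^ _)%E; apply: eq_integral => x _ /=.
by rewrite ger0_norm ?cmod_ge0// powR_mulrn// cmod_ge0.
Qed.

Lemma L2P f : L2 mu f <->
  cmeas f /\ mu.-integrable setT (fun x => (cmod (f x) ^+ 2)%:E).
Proof.
have h2 : (\int[mu]_x `|(cmod (f x) ^+ 2)%:E| =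
           \int[mu]_x (cmod (f x) ^+ 2)%:E)%E.
  by apply: eq_integral => x _; rewrite gee0_abs// lee_fin sqr_ge0.
have int0 : (0 <= \int[mu]_x (cmod (f x) ^+ 2)%:E)%E.
  by apply: integral_ge0 => x _; rewrite lee_fin sqr_ge0.
split.
  move=> [f1 f2]; rewrite cLnorm2E => f3; split => //; apply/integrableP; split.
    apply/measurable_EFinP; apply: measurable_funX; exact: cmeas_cmod.
  by rewrite h2; apply: lty_poweRy f3; rewrite invr_eq0 pnatr_eq0.
move=> [[f1 f2] /integrableP[_]]; rewrite h2 => h; split => //.
by rewrite cLnorm2E poweR_lty.
Qed.

Lemma L2_cmeas f : L2 mu f -> cmeas f. Proof. by move=> /L2P[]. Qed.

Lemma L2_sqr f : L2 mu f -> mu.-integrable setT (fun x => (cmod (f x) ^+ 2)%:E).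
Proof. by move=> /L2P[]. Qed.

Lemma L2_le f g : cmeas f -> L2 mu g -> (forall x, cmod (f x) <= cmod (g x)) ->
  L2 mu f.
Proof.
move=> mf /L2P[mg ig] fg; apply/L2P; split => //.
apply: le_integrable ig => //.
  apply/measurable_EFinP; apply: measurable_funX; exact: cmeas_cmod.
move=> x _; rewrite !gee0_abs ?lee_fin ?sqr_ge0//.
by rewrite lerXn2r ?nnegrE ?cmod_ge0.
Qed.

Lemma L2_cst (a : R[i]) : L2 mu (fun=> a).
Proof.
apply/L2P; split; first exact: cmeas_cst.
exact: finite_measure_integrable_cst.
Qed.

Lemma L2_bounded f (M : R) : cmeas f -> (forall x, cmod (f x) <= M) -> L2 mu f.
Proof.
move=> mf fM; apply: (L2_le mf (L2_cst M%:C)) => x.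
by rewrite cmodr (le_trans (fM x))// ler_norm.
Qed.

Lemma L2_lin (a : R[i]) f g : L2 mu f -> L2 mu g ->
  L2 mu (fun x => a * f x + g x).
Proof.
move=> /L2P[mf If] /L2P[mg Ig]; apply/L2P; split; first exact: cmeas_lin.
apply: (@le_integrable _ _ _ mu setT measurableT _
  (fun x => ((2 * cmod a ^+ 2)%:E * (cmod (f x) ^+ 2)%:E +
             2%:E * (cmod (g x) ^+ 2)%:E)%E)).
- apply/measurable_EFinP; apply: measurable_funX; apply: cmeas_cmod.
  exact: cmeas_lin.
- move=> x _; rewrite -!EFinM -EFinD !gee0_abs ?lee_fin ?sqr_ge0//; last first.
    by rewrite addr_ge0// mulr_ge0 ?sqr_ge0// mulr_ge0// sqr_ge0.
  apply: (@le_trans _ _ ((cmod (a * f x) + cmod (g x)) ^+ 2)).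
    by rewrite lerXn2r ?nnegrE ?addr_ge0 ?cmod_ge0// cmodD.
  rewrite cmodM -mulrA -exprMn; move: (cmod a * _) (cmod (g x)) => u v.
  have := sqr_ge0 (u - v); nra.
by apply: integrableD => //; apply: integrableZl.
Qed.

Lemma L2D f g : L2 mu f -> L2 mu g -> L2 mu (fun x => f x + g x).
Proof.
move=> Lf Lg; have := L2_lin 1 Lf Lg.
by under eq_fun do rewrite mul1r.
Qed.

Lemma L2Z (a : R[i]) f : L2 mu f -> L2 mu (fun x => a * f x).
Proof.
move=> Lf; have := L2_lin a Lf (L2_cst 0).
by under eq_fun do rewrite addr0.
Qed.

Lemma L2B f g : L2 mu f -> L2 mu g -> L2 mu (fun x => f x - g x).
Proof.
move=> Lf Lg; have := L2_lin (-1) Lg Lf.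
by under eq_fun do rewrite mulN1r addrC.
Qed.

Lemma L2J f : L2 mu f -> L2 mu (fun x => (f x)^*).
Proof.
by move=> Lf; apply: (L2_le _ Lf) => [|x]; [apply/cmeasJ/L2_cmeas|rewrite cmodJ].
Qed.

Lemma L2_sum I (s : seq I) (P : pred I) (F : I -> T -> R[i]) :
  (forall i, P i -> L2 mu (F i)) -> L2 mu (fun x => \sum_(i <- s | P i) F i x).
Proof.
move=> LF; elim: s => [|i s IH].
  have -> : (fun x => \sum_(i <- [::] | P i) F i x) = fun=> 0.
    by apply/funext => x; rewrite big_nil.
  exact: L2_cst.
have -> : (fun x => \sum_(j <- i :: s | P j) F j x) = fun x =>
    (if P i then F i x else 0) + \sum_(i <- s | P i) F i x.
  by apply/funext => x; rewrite [LHS]big_cons; case: (P i) => //; rewrite add0r.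
by apply: L2D => //; case Pi: (P i); [exact: LF|exact: L2_cst].
Qed.

Lemma L2_Mb f g (M : R) : cmeas g -> (forall x, cmod (g x) <= M) -> L2 mu f ->
  L2 mu (fun x => g x * f x).
Proof.
move=> mg gM Lf; apply: (L2_le _ (L2Z M%:C Lf)) => [|x].
  by apply: cmeasM => //; exact: L2_cmeas.
rewrite !cmodM cmodr ler_wpM2r ?cmod_ge0//.
by rewrite (le_trans (gM x))// ler_norm.
Qed.

Definition cintegrable f :=
  mu.-integrable setT (EFin \o (fun x => Re (f x))) /\
  mu.-integrable setT (EFin \o (fun x => Im (f x))).

Lemma cintegrable_le f (G : T -> R) : cmeas f -> mu.-integrable setT (EFin \o G) ->
  (forall x, cmod (f x) <= G x) -> cintegrable f.
Proof.
move=> [f1 f2] iG fG; split; apply: le_integrable iG => //;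
    try exact/measurable_EFinP.
  move=> x _; rewrite lee_fin (le_trans (cmod_Re _))// (le_trans (fG x))//.
  exact: ler_norm.
move=> x _; rewrite lee_fin (le_trans (cmod_Im _))// (le_trans (fG x))//.
exact: ler_norm.
Qed.

Lemma L2_cintegrable f g : L2 mu f -> L2 mu g -> cintegrable (fun x => f x * (g x)^*).
Proof.
move=> Lf Lg.
apply: (@cintegrable_le _ (fun x => cmod (f x) ^+ 2 + cmod (g x) ^+ 2)).
- by apply: cmeasM; [exact: L2_cmeas|apply/cmeasJ/L2_cmeas].
- exact: (integrableRD (L2_sqr Lf) (L2_sqr Lg)).
- move=> x; rewrite cmodM cmodJ.
  move: (cmod (f x)) (cmod (g x)) => u v.
  have := sqr_ge0 (u - v); have := sqr_ge0 (u + v); nra.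
Qed.

Lemma cintegral_lin (a : R[i]) f g : cintegrable f -> cintegrable g ->
  cintegral mu (fun x => a * f x + g x) = a * cintegral mu f + cintegral mu g.
Proof.
move=> [f1 f2] [g1 g2].
rewrite /cintegral; apply: complex_ext; rewrite !ReImE /=.
  under eq_Rintegral do rewrite !ReImE -mulNr.
  rewrite !RintegralD// ?RintegralZl//; try (by [exact: integrableRZ]); last by apply: integrableRD; exact: integrableRZ.
  by rewrite mulNr.
under eq_Rintegral do rewrite !ReImE.
by rewrite !RintegralD// ?RintegralZl//; try (by [exact: integrableRZ]); apply: integrableRD; exact: integrableRZ.
Qed.

Lemma cinner_lin (a : R[i]) f g h : L2 mu f -> L2 mu g -> L2 mu h ->
  cinner mu (fun x => a * f x + g x) h = a * cinner mu f h + cinner mu g h.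
Proof.
move=> Lf Lg Lh; rewrite /cinner -cintegral_lin; try exact: L2_cintegrable.
by congr cintegral; apply/funext => x; ring.
Qed.

Lemma cinnerC f g : L2 mu f -> L2 mu g -> cinner mu g f = (cinner mu f g)^*.
Proof.
move=> Lf Lg; have [_ i2] := L2_cintegrable Lf Lg; rewrite /cinner /cintegral; apply: complex_ext => /=.
  by apply: eq_Rintegral => x _; rewrite !ReImE; ring.
rewrite -mulN1r -RintegralZl//.
by apply: eq_Rintegral => x _; rewrite !ReImE; ring.
Qed.

End L2Basics.

Section L2Norm.
Context {d} {T : measurableType d} {R : realType} (mu : probability T R).
Local Notation Re := complex.Re.
Local Open Scope complex_scope.
Local Notation "z ^*" := (Num.conj z) : complex_scope.
Implicit Types f g h : T -> R[i].

(** Real-valued, so that real arithmetic applies. It agrees with [cLnorm] on [L2] ([cLnorm_nrm]);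
    elsewhere an infinite integral is sent to 0 and the value is meaningless. *)
Definition nrm f : R := Num.sqrt (\int[mu]_x (cmod (f x) ^+ 2)).

Lemma nrm_ge0 f : 0 <= nrm f. Proof. exact: sqrtr_ge0. Qed.

Lemma nrm_sqr f : nrm f ^+ 2 = \int[mu]_x (cmod (f x) ^+ 2).
Proof. by rewrite sqr_sqrtr// Rintegral_ge0// => x _; exact: sqr_ge0. Qed.

Lemma cinner_nrm f : cinner mu f f = (nrm f ^+ 2)%:C.
Proof.
rewrite nrm_sqr /cinner /cintegral; apply: complex_ext => /=.
  by apply: eq_Rintegral => x _; rewrite mulJ_sqr.
rewrite -[RHS](@mul0r _ (fine (mu setT))) -(@Rintegral_cst _ _ _ mu)//.
by apply: eq_Rintegral => x _; rewrite mulJ_sqr.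
Qed.

Lemma Re_cinner f g : Re (cinner mu f g) = \int[mu]_x Re (f x * (g x)^*).
Proof. by []. Qed.

Lemma cinner_eq0 f g : (forall x, f x * (g x)^* = 0) -> cinner mu f g = 0.
Proof.
move=> fg; rewrite /cinner /cintegral.
by apply: complex_ext => /=; (under eq_Rintegral do rewrite fg /=);
  rewrite Rintegral_cst// mul0r.
Qed.

Lemma cLnorm_nrm f : L2 mu f -> cLnorm mu 2%:E f = (nrm f)%:E.
Proof.
move=> Lf; rewrite cLnorm2E.
have i0 : (0 <= \int[mu]_x (cmod (f x) ^+ 2)%:E)%E.
  by apply: integral_ge0 => x _; rewrite lee_fin sqr_ge0.
rewrite /nrm /Rintegral -powR12_sqrt; last exact: fine_ge0.
by rewrite -poweR_EFin fineK// (integrable_fin_num _ (L2_sqr Lf)).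
Qed.

Lemma eq_nrm f g : (forall x, cmod (f x) = cmod (g x)) -> nrm f = nrm g.
Proof.
by move=> fg; congr Num.sqrt; apply: eq_Rintegral => x _; rewrite fg.
Qed.

Lemma cinner0l f : cinner mu (fun=> 0) f = 0.
Proof.
rewrite /cinner /cintegral.
by apply: complex_ext => /=; (under eq_Rintegral do rewrite mul0r /=);
  rewrite Rintegral_cst// mul0r.
Qed.

Lemma cinnerZl (a : R[i]) f h : L2 mu f -> L2 mu h ->
  cinner mu (fun x => a * f x) h = a * cinner mu f h.
Proof.
move=> Lf Lh; have := cinner_lin a Lf (L2_cst mu 0) Lh.
by rewrite cinner0l addr0 => <-; congr (cinner mu _ h); apply/funext => x; rewrite addr0.
Qed.

Lemma cinnerDl f g h : L2 mu f -> L2 mu g -> L2 mu h ->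
  cinner mu (fun x => f x + g x) h = cinner mu f h + cinner mu g h.
Proof.
move=> Lf Lg Lh; have := cinner_lin 1 Lf Lg Lh.
by rewrite mul1r => <-; congr (cinner mu _ h); apply/funext => x; rewrite mul1r.
Qed.

Lemma cinnerBl f g h : L2 mu f -> L2 mu g -> L2 mu h ->
  cinner mu (fun x => f x - g x) h = cinner mu f h - cinner mu g h.
Proof.
move=> Lf Lg Lh; have := cinner_lin (-1) Lg Lf Lh.
rewrite mulN1r addrC => <-; congr (cinner mu _ h); apply/funext => x.
by rewrite mulN1r addrC.
Qed.

Lemma cinnerZr (a : R[i]) f h : L2 mu f -> L2 mu h ->
  cinner mu h (fun x => a * f x) = a^* * cinner mu h f.
Proof.
move=> Lf Lh; rewrite cinnerC ?cinnerZl//; last exact: L2Z.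
by rewrite conjMc -cinnerC.
Qed.

Lemma cinnerDr f g h : L2 mu f -> L2 mu g -> L2 mu h ->
  cinner mu h (fun x => f x + g x) = cinner mu h f + cinner mu h g.
Proof.
move=> Lf Lg Lh; rewrite cinnerC ?cinnerDl//; last exact: L2D.
by rewrite conjDc -!cinnerC.
Qed.

Lemma cinnerBr f g h : L2 mu f -> L2 mu g -> L2 mu h ->
  cinner mu h (fun x => f x - g x) = cinner mu h f - cinner mu h g.
Proof.
move=> Lf Lg Lh; rewrite cinnerC ?cinnerBl//; last exact: L2B.
by rewrite rmorphB /= -!cinnerC.
Qed.

Lemma cinner_suml I (s : seq I) (P : pred I) (F : I -> T -> R[i]) h :
  (forall i, P i -> L2 mu (F i)) -> L2 mu h ->
  cinner mu (fun x => \sum_(i <- s | P i) F i x) h =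
  \sum_(i <- s | P i) cinner mu (F i) h.
Proof.
move=> LF Lh; elim: s => [|i s IH].
  rewrite big_nil -[RHS](cinner0l h); congr (cinner mu _ h).
  by apply/funext => x; rewrite big_nil.
rewrite big_cons; have [Pi|Pi] := boolP (P i); last first.
  by rewrite -IH; congr (cinner mu _ h); apply/funext => x; rewrite big_cons (negbTE Pi).
rewrite -IH -cinnerDl//; [|exact: LF|exact: L2_sum].
by congr (cinner mu _ h); apply/funext => x; rewrite big_cons Pi.
Qed.

Lemma cinner_sumr I (s : seq I) (P : pred I) (F : I -> T -> R[i]) h :
  (forall i, P i -> L2 mu (F i)) -> L2 mu h ->
  cinner mu h (fun x => \sum_(i <- s | P i) F i x) =
  \sum_(i <- s | P i) cinner mu h (F i).
Proof.
move=> LF Lh; rewrite cinnerC ?cinner_suml//; last exact: L2_sum.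
by rewrite rmorph_sum; apply: eq_bigr => i Pi /=; rewrite -cinnerC//; exact: LF.
Qed.

Lemma nrm_lin_sqr (a : R[i]) f g : L2 mu f -> L2 mu g ->
  nrm (fun x => a * f x + g x) ^+ 2 =
  cmod a ^+ 2 * nrm f ^+ 2 + 2 * Re (a * cinner mu f g) + nrm g ^+ 2.
Proof.
move=> Lf Lg; apply: complexI; rewrite -cinner_nrm cinner_lin//; last exact: L2_lin.
have Laf := L2Z a Lf.
rewrite !cinnerDr// !cinnerZr// !cinner_nrm [cinner mu g f]cinnerC// mulrDr.
rewrite mulrA mulJ_sqr; apply: complex_ext; rewrite !ReImE /= ?ReImE /=; ring.
Qed.

Lemma nrmZ (a : R[i]) f : L2 mu f -> nrm (fun x => a * f x) = cmod a * nrm f.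
Proof.
move=> Lf; apply/eqP; rewrite -(@eqrXn2 _ 2) ?nrm_ge0 ?mulr_ge0 ?cmod_ge0 ?nrm_ge0//.
apply/eqP/complexI; rewrite -cinner_nrm cinnerZl ?cinnerZr//; last exact: L2Z.
by rewrite mulrA mulJ_sqr cinner_nrm -rmorphM exprMn.
Qed.

Lemma cauchy_schwarz f g : L2 mu f -> L2 mu g ->
  cmod (cinner mu f g) <= nrm f * nrm g.
Proof.
move=> Lf Lg; set c := cinner mu f g.
rewrite -(@ler_pXn2r _ 2) ?nnegrE ?mulr_ge0 ?nrm_ge0 ?cmod_ge0// exprMn.
(* Expands the squared norm of [f - t c g]; the useful [t] is the minimiser [1 / |g|^2]. *)
have key (t : R) : 0 <= t ^+ 2 * cmod c ^+ 2 * nrm g ^+ 2 - 2 * t * cmod c ^+ 2 + nrm f ^+ 2.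
  have := sqr_ge0 (nrm (fun x => - (t%:C * c) * g x + f x)).
  rewrite nrm_lin_sqr// cmodN cmodM cmodr exprMn -normrX (ger0_norm (sqr_ge0 t)).
  rewrite [cinner mu g f]cinnerC// -/c.
  have -> : Re (- (t%:C * c) * c^*) = - (t * cmod c ^+ 2).
    by rewrite mulNr ReN -mulrA mulJ_sqr -rmorphM.
  by rewrite mulrN [2 * (t * _)]mulrA.
have [g0|g0] := eqVneq (nrm g) 0.
  have [->|c0] := eqVneq (cmod c ^+ 2) 0; first by rewrite mulr_ge0// sqr_ge0.
  (* For [g] of norm 0 the bound [key] is affine in [t], and this [t] makes its right-hand side
     equal to -1. *)
  have := key ((nrm f ^+ 2 + 1) / (2 * cmod c ^+ 2)).
  rewrite g0 expr0n mulr0 sub0r.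
  have -> : 2 * ((nrm f ^+ 2 + 1) / (2 * cmod c ^+ 2)) * cmod c ^+ 2 = nrm f ^+ 2 + 1.
    by field; rewrite -sqrf_eq0.
  by move=> ?; exfalso; lra.
have g2 : 0 < nrm g ^+ 2 by rewrite exprn_gt0// lt_def g0 nrm_ge0.
have := key (nrm g ^+ 2)^-1.
have -> : (nrm g ^+ 2)^-1 ^+ 2 * cmod c ^+ 2 * nrm g ^+ 2 -
  2 * (nrm g ^+ 2)^-1 * cmod c ^+ 2 + nrm f ^+ 2 =
  nrm f ^+ 2 - cmod c ^+ 2 / nrm g ^+ 2 by field.
by rewrite subr_ge0 ler_pdivrMr.
Qed.

Lemma nrmD f g : L2 mu f -> L2 mu g -> nrm (fun x => f x + g x) <= nrm f + nrm g.
Proof.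
move=> Lf Lg; rewrite -(@ler_pXn2r _ 2) ?nnegrE ?addr_ge0 ?nrm_ge0//.
have := nrm_lin_sqr 1 Lf Lg; under eq_fun do rewrite mul1r.
move=> ->; rewrite mul1r sqrrD.
have -> : cmod (1 : R[i]) = 1 by rewrite (_ : 1 = 1%:C)// cmodr normr1.
have : Re (cinner mu f g) <= nrm f * nrm g.
  by rewrite (le_trans (ler_norm _))// (le_trans (cmod_Re _))// cauchy_schwarz.
rewrite expr1n mul1r mulr2n; lra.
Qed.

Lemma nrmBC f g : nrm (fun x => f x - g x) = nrm (fun x => g x - f x).
Proof. by apply: eq_nrm => x; rewrite -cmodN opprB. Qed.

Lemma nrmB_trans f g h : L2 mu f -> L2 mu g -> L2 mu h ->
  nrm (fun x => f x - h x) <= nrm (fun x => f x - g x) + nrm (fun x => g x - h x).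
Proof.
move=> Lf Lg Lh; apply: le_trans (nrmD (L2B Lf Lg) (L2B Lg Lh)).
by rewrite le_eqVlt; apply/orP; left; apply/eqP/eq_nrm => x; congr cmod; ring.
Qed.

Lemma nrm_le_bound f (M : R) : cmeas f -> (forall x, cmod (f x) <= M) -> nrm f <= M.
Proof.
move=> mf fM; have M0 : 0 <= M := le_trans (cmod_ge0 _) (fM point).
rewrite -(@ler_pXn2r _ 2) ?nnegrE ?nrm_ge0// nrm_sqr.
have -> : M ^+ 2 = \int[mu]_x (M ^+ 2).
  rewrite Rintegral_cst//; have /(congr1 fine) /= -> := probability_setT mu.
  by rewrite mulr1.
apply: le_Rintegral => //.
- by have := L2_sqr (L2_bounded mu mf fM).
- exact: finite_measure_integrable_cst.
- by move=> x _; rewrite lerXn2r ?nnegrE ?cmod_ge0.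
Qed.

Lemma nrm_eq0P f : L2 mu f -> (nrm f = 0 <-> {ae mu, forall x, f x = 0}).
Proof.
move=> Lf; have [mf If] := L2P mu f; have mc := cmeas_cmod (L2_cmeas Lf).
have mc2 : measurable_fun setT (fun x => (cmod (f x) ^+ 2)%:E).
  by apply/measurable_EFinP; exact: measurable_funX.
have := ae_eq_integral_abs mu measurableT mc2.
have -> : (\int[mu]_x `|(cmod (f x) ^+ 2)%:E| = (nrm f ^+ 2)%:E)%E.
  rewrite nrm_sqr /Rintegral fineK ?(integrable_fin_num _ (L2_sqr Lf))//.
  by apply: eq_integral => x _; rewrite gee0_abs// lee_fin sqr_ge0.
move=> [h1 h2]; split.
  move=> f0; rewrite f0 expr0n in h1; have := h1 erefl.
  apply: filterS => x /(_ I) [] /eqP; rewrite sqrf_eq0 => /eqP.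
  exact: cmod_eq0.
move=> f0; apply/eqP; rewrite -sqrf_eq0; apply/eqP.
suff : (nrm f ^+ 2)%:E = 0%:E by case.
apply: h2; apply: filterS f0 => x -> _; by rewrite cmod0 expr0n.
Qed.

End L2Norm.

(** * Orthonormal families and closed subspaces *)

Section Orthonormal.
Context {d} {T : measurableType d} {R : realType} (mu : probability T R).
Local Open Scope complex_scope.
Implicit Types (f g h : T -> R[i]) (V : set (T -> R[i])).

Definition orthonormal k (e : 'I_k -> T -> R[i]) :=
  forall i j, cinner mu (e i) (e j) = (i == j)%:R.

Lemma bessel k (e : 'I_k -> T -> R[i]) f : (forall i, L2 mu (e i)) ->
  orthonormal e -> L2 mu f ->
  \sum_(i < k) cmod (cinner mu f (e i)) ^+ 2 <= nrm mu f ^+ 2.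
Proof.
move=> Le oe Lf; pose c i := cinner mu f (e i).
have LcE i : L2 mu (fun x => c i * e i x) by exact: L2Z.
have Ls : L2 mu (fun x => \sum_(i < k) c i * e i x) by exact: L2_sum.
pose g x := f x - \sum_(i < k) c i * e i x.
have Lg : L2 mu g by exact: L2B.
have eg i : cinner mu (e i) g = 0.
  rewrite cinnerBr// cinner_sumr// (bigD1 i)//= cinnerZr// oe eqxx mulr1.
  rewrite big1 ?addr0; first by rewrite [cinner mu (e i) f]cinnerC// subrr.
  by move=> j ji; rewrite cinnerZr// oe eq_sym (negbTE ji) mulr0.
have gg : cinner mu g g = (nrm mu f ^+ 2 - \sum_(i < k) cmod (c i) ^+ 2)%:C.
  rewrite {1}/g cinnerBl// cinner_suml// big1 ?subr0; last first.
    by move=> i _; rewrite cinnerZl// eg mulr0.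
  rewrite cinnerBr// cinner_nrm cinner_sumr// rmorphB rmorph_sum; congr (_ - _).
  by apply: eq_bigr => i _; rewrite cinnerZr// mulrC mulJ_sqr.
rewrite -subr_ge0; move: gg; rewrite cinner_nrm => /complexI <-.
exact: sqr_ge0.
Qed.

Definition linear_set V := [/\ V `<=` L2 mu, V (fun=> 0) &
  forall (a : R[i]) f g, V f -> V g -> V (fun x => a * f x + g x)].

Lemma linear_setZ V a f : linear_set V -> V f -> V (fun x => a * f x).
Proof.
move=> [_ V0 Vl] Vf; have := Vl a f _ Vf V0.
by under eq_fun do rewrite addr0.
Qed.

Lemma linear_setD V f g : linear_set V -> V f -> V g -> V (fun x => f x + g x).
Proof.
move=> [_ V0 Vl] Vf Vg; have := Vl 1 f g Vf Vg.
by under eq_fun do rewrite mul1r.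
Qed.

Lemma linear_setB V f g : linear_set V -> V f -> V g -> V (fun x => f x - g x).
Proof.
move=> [_ V0 Vl] Vf Vg; have := Vl (-1) g f Vg Vf.
by under eq_fun do rewrite mulN1r addrC.
Qed.

Lemma linear_set_sum V k (F : 'I_k -> T -> R[i]) : linear_set V ->
  (forall i, V (F i)) -> V (fun x => \sum_(i < k) F i x).
Proof.
move=> lV VF; have := lV => -[_ V0 _].
suff H (s : seq 'I_k) : V (fun x => \sum_(i <- s) F i x) by exact: H.
elim: s => [|i s IH].
  have -> : (fun x => \sum_(i <- [::]) F i x) = fun=> 0.
    by apply/funext => x; rewrite big_nil.
  exact: V0.
have -> : (fun x => \sum_(j <- i :: s) F j x) = fun x =>
    F i x + \sum_(i <- s) F i x.
  by apply/funext => x; rewrite big_cons.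
exact: linear_setD.
Qed.

(** A Gram-Schmidt argument by rank: with [m < k] orthonormal functions at hand, the [k] by [m]
    matrix of inner products has a nonzero left kernel vector, that is, a combination of the [b i]
    orthogonal to all of them. Independence makes its norm nonzero, so it can be normalised and
    appended. *)
Lemma lin_indep_orthonormal V k (b : 'I_k -> T -> R[i]) : linear_set V ->
  (forall i, V (b i)) -> lin_indep mu b ->
  exists e : 'I_k -> T -> R[i], (forall i, V (e i)) /\ orthonormal e.
Proof.
move=> lV Vb lb; have := lV => -[VL V0 Vl].
suff H m : (m <= k)%N ->
    exists e : 'I_m -> T -> R[i], (forall i, V (e i)) /\ orthonormal e by exact: H.
elim: m => [_|m IH mk]; first by exists (fun i x => 0); split=> -[].
have [e [Ve oe]] := IH (ltnW mk).
pose M : 'M[R[i]]_(k, m) := \matrix_(i, j) cinner mu (b i) (e j).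
have : kermx M != 0.
  by rewrite kermx_eq0 /row_free; apply: contraTN mk => /eqP <-; rewrite -leqNgt rank_leq_col.
move=> /rowV0Pn[a /sub_kermxP aM a0].
pose v x := \sum_(i < k) a 0 i * b i x.
have Vv : V v.
  by apply: (linear_set_sum (F := fun i x => a 0 i * b i x)) => // i; apply: linear_setZ.
have ve j : cinner mu v (e j) = 0.
  have := congr1 (fun N : 'rV[R[i]]_m => N 0 j) aM; rewrite !mxE => <-.
  rewrite cinner_suml; [|by move=> i _; exact/L2Z/VL|exact: VL].
  by apply: eq_bigr => i _; rewrite mxE cinnerZl//; exact: VL.
have nv : nrm mu v != 0.
  apply: contra a0 => /eqP /(nrm_eq0P (VL _ Vv)) /lb a0.
  by apply/eqP/rowP => i; rewrite a0 mxE.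
pose w x := (nrm mu v)^-1%:C * v x.
have Vw : V w by exact: linear_setZ.
have we j : cinner mu w (e j) = 0 by rewrite cinnerZl ?ve ?mulr0//; exact: VL.
exists (fun i => if unlift ord_max i is Some j then e j else w); split.
  by move=> i; case: unliftP.
move=> i j; case: unliftP => [i'|] ->; case: unliftP => [j'|] ->.
- by rewrite oe (inj_eq lift_inj).
- rewrite cinnerC; [|exact: VL|exact/VL/Ve].
  by rewrite we rmorph0 eq_sym (negbTE (neq_lift _ _)).
- by rewrite we (negbTE (neq_lift _ _)).
- rewrite eqxx cinner_nrm nrmZ; last exact: VL.
  by rewrite cmodr ger0_norm ?invr_ge0 ?nrm_ge0// mulVf// expr1n.
Qed.

Lemma closed_linear V : closed_subspace mu V -> linear_set V.
Proof. by case. Qed.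

Lemma closed_L2 V f : closed_subspace mu V -> V f -> L2 mu f.
Proof. by move=> [+ _ _ _]; exact. Qed.

Lemma closed_lim V (u : nat -> T -> R[i]) f : closed_subspace mu V ->
  (forall k, V (u k)) -> L2 mu f ->
  (fun k => nrm mu (fun x => u k x - f x)) @ \oo --> (0 : R) -> V f.
Proof.
move=> [VL _ _ Vc] Vu Lf uf; apply: (Vc _ _ Vu Lf).
have -> : (fun k => cLnorm mu 2%:E (fun x => u k x - f x)) =
    (fun k => (nrm mu (fun x => u k x - f x))%:E).
  by apply/funext => k; rewrite cLnorm_nrm//; apply: L2B => //; exact: VL.
by apply: cvg_EFin => //; exact: nearW.
Qed.

Lemma closed_nrm0 V f g : closed_subspace mu V -> V f -> L2 mu g ->
  nrm mu (fun x => f x - g x) = 0 -> V g.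
Proof.
move=> cV Vf Lg fg; apply: (closed_lim (u := fun=> f)) => //.
by rewrite fg; exact: cvg_cst.
Qed.

End Orthonormal.

(** * Moment sequences *)

Section MomentSequence.
Context {R : realType}.

(* Iterating [a_{2m+1} <= a_m^2] gives [a_n <= theta^(2^k) rho^(n+1)] along
   [n = 2^k (m+1) - 1] if [a_m = theta rho^(m+1)], whereas [a_n] eventually
   grows at least like [rho^n]. *)
Lemma log_convex_ratio_le (a : nat -> R) (rho c0 : R) (m0 : nat) :
  0 < rho -> 0 < c0 ->
  (forall n, (m0 <= n)%N -> c0 * rho ^+ n <= a n) ->
  (forall m, 0 <= a m) -> (forall m, a (2 * m).+1 <= a m ^+ 2) ->
  forall m, rho ^+ m.+1 <= a m.
Proof.
move=> rho0 c0_gt0 lb a0 asq m; rewrite leNgt; apply/negP => am.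
pose th := a m / rho ^+ m.+1.
have rm : 0 < rho ^+ m.+1 by rewrite exprn_gt0.
have th0 : 0 <= th by rewrite divr_ge0// ltW.
have th1 : th < 1 by rewrite ltr_pdivrMr// mul1r.
pose n k := (2 ^ k * m.+1).-1.
have nS k : (n k).+1 = (2 ^ k * m.+1)%N by rewrite prednK// muln_gt0 expn_gt0.
have n2 k : n k.+1 = (2 * n k).+1.
  by apply/succn_inj; rewrite nS expnS -mulnA -nS; lia.
have ub k : a (n k) <= th ^+ (2 ^ k) * rho ^+ (n k).+1.
  elim: k => [|k IH].
    by rewrite nS expn0 mul1n expr1 /n expn0 mul1n /= /th divfK// gt_eqF.
  rewrite n2 (le_trans (asq _))//.
  apply: (le_trans (y := (th ^+ (2 ^ k) * rho ^+ (n k).+1) ^+ 2)).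
    by rewrite lerXn2r// nnegrE// mulr_ge0 ?exprn_ge0// ltW.
  rewrite exprMn -!exprM le_eqVlt; apply/orP; left; apply/eqP.
  by congr (_ ^+ _ * _ ^+ _); rewrite ?expnS; lia.
have th_cvg : (fun k => th ^+ k * rho) @ \oo --> (0 : R).
  rewrite -(mul0r rho); apply: cvgM; last exact: cvg_cst.
  by apply: cvg_expr; rewrite ger0_norm.
have /cvgrPdist_lt/(_ _ c0_gt0) := th_cvg.
move=> [N _ hN]; pose k := maxn N m0.
have k2 : (k <= 2 ^ k)%N by exact/ltnW/ltn_expl.
have := hN (2 ^ k)%N; rewrite /= sub0r normrN ger0_norm; last first.
  by rewrite mulr_ge0 ?exprn_ge0// ltW.
move=> /(_ (leq_trans (leq_maxl _ _) k2)); apply/negP; rewrite -leNgt.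
have mk : (m0 <= n k)%N.
  rewrite -ltnS nS (leq_ltn_trans (leq_maxr N m0))//.
  by rewrite (leq_trans (ltn_expl k (isT : (1 < 2)%N)))// leq_pmulr.
have := le_trans (lb _ mk) (ub k).
by rewrite exprS mulrA ler_pM2r// exprn_gt0.
Qed.

(** Log-convexity makes the ratios [r m] nondecreasing, so [a] grows at least geometrically with any
    of them from its index on, and [log_convex_ratio_le] applies to each. At [m = 0] this bounds
    every ratio by [a 0]; [lam] is their supremum. *)
Lemma log_convex_growth (a : nat -> R) :
  (forall m, 0 < a m) -> (forall m, a m.+1 ^+ 2 <= a m * a m.+2) ->
  (forall m, a (2 * m).+1 <= a m ^+ 2) ->
  exists lam : R, [/\ 0 < lam, forall m, a m.+1 <= lam * a m &
    forall m, lam ^+ m.+1 <= a m].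
Proof.
move=> a0 lc asq.
pose r m := a m.+1 / a m.
have r0 m : 0 < r m by rewrite divr_gt0.
have rS m : r m <= r m.+1.
  rewrite /r ler_pdivrMr// mulrAC ler_pdivlMr// -expr2.
  by rewrite (le_trans (lc m))// mulrC.
have key m0 m : r m0 ^+ m.+1 <= a m.
  apply: (@log_convex_ratio_le a (r m0) (a m0 / r m0 ^+ m0) m0) => //.
  - by rewrite divr_gt0// exprn_gt0.
  - move=> n /subnK <-; elim: (n - m0)%N => [|j IH].
      by rewrite add0n divfK// gt_eqF// exprn_gt0.
    rewrite addSn exprS mulrCA.
    apply: (le_trans (y := r m0 * a (j + m0)%N)); first by rewrite ler_pM2l.
    have : r m0 <= r (j + m0)%N.
      by elim: (j) => // i; rewrite addSn => /le_trans; apply.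
    by rewrite {2}/r ler_pdivlMr.
  - by move=> i; exact: ltW.
pose S := range r.
have S0 : S !=set0 by exists (r 0%N); exists 0%N.
have Sb : has_ubound S.
  by exists (a 0%N) => _ [m _ <-]; have := key m 0%N; rewrite expr1.
have rs m : r m <= sup S by apply: ub_le_sup => //; exists m.
have s0 : 0 < sup S := lt_le_trans (r0 0%N) (rs 0%N).
exists (sup S); split => // m; first by have := rs m; rewrite /r ler_pdivrMr.
have am m1 : 0 <= a m1 by exact: ltW.
(* After taking roots of order [m + 1], the bounds [key] on the single ratios pass to their
   supremum. *)
suff : sup S <= a m `^ (m.+1%:R^-1).
  rewrite -(@ler_pXn2r _ m.+1) ?nnegrE ?powR_ge0 ?(ltW s0)//.
  by rewrite -[leRHS]powR_mulrn ?powR_ge0// -powRrM mulVf ?pnatr_eq0// powRr1.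
apply: ge_sup => // _ [i _ <-].
rewrite -(@ler_pXn2r _ m.+1) ?nnegrE ?powR_ge0 ?(ltW (r0 i))//.
by rewrite -[leRHS]powR_mulrn ?powR_ge0// -powRrM mulVf ?pnatr_eq0// powRr1.
Qed.

End MomentSequence.

(** * Approximation in [L^2] *)

Import HBSimple HBNNSimple.
Section L2Induction.
Context {d} {T : measurableType d} {R : realType} (mu : probability T R).
Local Notation Re := complex.Re.
Local Notation Im := complex.Im.
Local Open Scope complex_scope.

Definition L2_lim_closed (Phi : set (T -> R[i])) := forall f, L2 mu f ->
  (forall e : R, 0 < e ->
    exists u, [/\ Phi u, L2 mu u & nrm mu (fun x => f x - u x) <= e]) -> Phi f.

Definition lin_closed (Phi : set (T -> R[i])) := forall (a : R[i]) f g,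
  Phi f -> Phi g -> Phi (fun x => a * f x + g x).

Lemma L2_real (g : T -> R) (f : T -> R[i]) : measurable_fun setT g -> L2 mu f ->
  (forall x, `|g x| <= cmod (f x)) -> L2 mu (fun x => (g x)%:C).
Proof.
move=> mg Lf gf; apply: L2_le Lf _; first by split => //=; exact: measurable_cst.
by move=> x; rewrite cmodr.
Qed.

(** The usual ladder: indicators, simple functions, nonnegative, real and finally complex functions.
    Only the passage from simple to nonnegative functions uses the limit hypothesis. *)
Lemma L2_ind (Phi : set (T -> R[i])) : lin_closed Phi -> L2_lim_closed Phi ->
  (forall A, measurable A -> Phi (fun x => (\1_A x)%:C)) ->
  forall f, L2 mu f -> Phi f.
Proof.
move=> Plin Plim Pind.
have Pext f g : f =1 g -> Phi f -> Phi g by move=> /funext ->.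
have P0 : Phi (fun=> 0).
  apply: Pext (Pind set0 measurable0) => x.
  by rewrite indicE in_set0.
have PZ a f : Phi f -> Phi (fun x => a * f x).
  by move=> Pf; apply: Pext (Plin a f _ Pf P0) => x; rewrite addr0.
have PD f g : Phi f -> Phi g -> Phi (fun x => f x + g x).
  by move=> Pf Pg; apply: Pext (Plin 1 f g Pf Pg) => x; rewrite mul1r.
have Pnn (g : T -> R) : measurable_fun setT g -> (forall x, 0 <= g x) ->
    L2 mu (fun x => (g x)%:C) -> Phi (fun x => (g x)%:C).
  move=> mg g0 Lg.
  have meg : measurable_fun setT (EFin \o g) by exact/measurable_EFinP.
  pose phi := nnsfun_approx measurableT meg.
  have phic x : phi n x @[n --> \oo] --> g x.
    have f0 y : setT y -> (0 <= (EFin \o g) y)%E by move=> _; rewrite lee_fin.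
    exact: (fine_cvg (cvg_nnsfun_approx measurableT meg f0 (x := x) I)).
  have phile n x : phi n x <= g x.
    rewrite -(cvg_lim (@Rhausdorff R) (phic x)).
    apply: (@nondecreasing_cvgn_le _ (fun n => phi n x)); last first.
      by apply/cvg_ex; exists (g x).
    by move=> i j ij; have /lefP := nd_nnsfun_approx measurableT meg ij; exact.
  have phi0 n x : 0 <= phi n x by [].
  have Lphi n : L2 mu (fun x => (phi n x)%:C).
    apply: (L2_real _ Lg) => // x.
    by rewrite cmodr !ger0_norm.
  have Pphi n : Phi (fun x => (phi n x)%:C).
    have [s Hs] : exists s : seq R, forall x,
        phi n x = \sum_(y <- s) y * \1_(phi n @^-1` [set y]) x.
      by eexists => x; rewrite fimfunE fsbig_finite.
    apply: (Pext (fun x => \sum_(y <- s) y%:C * (\1_(phi n @^-1` [set y]) x)%:C)).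
      by move=> x; rewrite Hs rmorph_sum; apply: eq_bigr => i _; rewrite -rmorphM.
    elim: {Hs} s => [|y s IH].
      by apply: Pext P0 => x; rewrite big_nil.
    apply: (Pext (fun x => y%:C * (\1_(phi n @^-1` [set y]) x)%:C +
        \sum_(z <- s) z%:C * (\1_(phi n @^-1` [set z]) x)%:C)).
      by move=> x; rewrite big_cons.
    by apply: Plin => //; exact: Pind.
  apply: Plim => // e e0.
  pose F n x := ((g x - phi n x) ^+ 2)%:E.
  (* Since [0 <= phi n <= g], the squared error is dominated by [g^2], so pointwise convergence
     becomes convergence in [L2]. *)
  have [] := @dominated_convergence _ _ _ mu setT measurableT F (fun=> 0%E)
      (fun x => (cmod (g x)%:C ^+ 2)%:E).
  - move=> n; apply/measurable_EFinP; apply: measurable_funX.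
    exact: measurable_funB.
  - exact: measurable_cst.
  - apply: aeW => x _; apply: cvg_EFin; first exact: nearW.
    have : (fun n => (g x - phi n x) * (g x - phi n x)) @ \oo -->
        (g x - g x) * (g x - g x).
      by apply: cvgM; apply: cvgB => //; exact: cvg_cst.
    by rewrite subrr mulr0.
  - exact: L2_sqr.
  - apply: aeW => x n _; rewrite gee0_abs ?lee_fin ?sqr_ge0//.
    rewrite cmodr lerXn2r ?nnegrE ?subr_ge0// ger0_norm//.
    by rewrite gerBl.
  move=> _ _; rewrite integral0 => /fine_cvg /cvgrPdist_lt /(_ (e ^+ 2)).
  rewrite exprn_gt0// => /(_ isT)[N _ /(_ N (leqnn N))].
  rewrite /= sub0r normrN ger0_norm; last first.
    by apply: fine_ge0; apply: integral_ge0 => x _; rewrite lee_fin sqr_ge0.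
  move=> hN; exists (fun x => (phi N x)%:C); split => //.
  rewrite -(@ler_pXn2r _ 2) ?nnegrE ?nrm_ge0 ?(ltW e0)// nrm_sqr.
  apply: le_trans (ltW hN); rewrite le_eqVlt; apply/orP; left; apply/eqP.
  by apply: eq_Rintegral => x _; rewrite -rmorphB cmodr real_normK ?num_real.
have Prl (g : T -> R) : measurable_fun setT g ->
    L2 mu (fun x => (g x)%:C) -> Phi (fun x => (g x)%:C).
  move=> mg Lg.
  apply: (Pext (fun x => (-1) * (g^\- x)%:C + (g^\+ x)%:C)).
    move=> x; rewrite mulN1r -rmorphN -rmorphD addrC.
    by congr (_%:C); exact: (congr1 (fun h => h x) (funrposBneg g)).
  apply: Plin; apply: Pnn.
  - exact: measurable_funrneg.
  - exact: funrneg_ge0.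
  - apply: (L2_real _ Lg); first exact: measurable_funrneg.
    move=> x; rewrite cmodr ger0_norm ?funrneg_ge0// /funrneg /= ge_max normr_ge0 andbT.
    by rewrite -normrN ler_norm.
  - exact: measurable_funrpos.
  - exact: funrpos_ge0.
  - apply: (L2_real _ Lg); first exact: measurable_funrpos.
    move=> x; rewrite cmodr ger0_norm ?funrpos_ge0// /funrpos /= ge_max normr_ge0 andbT.
    by rewrite ler_norm.
move=> f Lf; have [m1 m2] := L2_cmeas Lf.
apply: (Pext (fun x => 'i * (Im (f x))%:C + (Re (f x))%:C)).
  by move=> x; rewrite addrC -complexE.
apply: Plin; apply: Prl => //.
  by apply: (L2_real _ Lf) => // x; exact: cmod_Im.
by apply: (L2_real _ Lf) => // x; exact: cmod_Re.
Qed.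

End L2Induction.

(** * A Fubini identity for kernels *)

Section Kernels.
Context {d} {T : measurableType d} {R : realType} (mu : probability T R).
Local Open Scope complex_scope.
Local Notation "z ^*" := (Num.conj z) : complex_scope.
Implicit Types (f g h w : T -> R[i]) (H K : T -> T -> R[i]).

(** A uniform limit is measurable as a pointwise limit, and it differs from the first approximant by
    a function bounded by 1. This is the source of measurability for functions such as
    [x |-> <H x, g>]. *)
Lemma L2_unif f : (forall e : R, 0 < e ->
    exists2 u, L2 mu u & forall x, cmod (f x - u x) <= e) -> L2 mu f.
Proof.
move=> fu.
have /choice[u hu] (n : nat) : exists u, L2 mu u /\
    forall x, cmod (f x - u x) <= n.+1%:R^-1.
  by have [|u Lu fu1] := fu n.+1%:R^-1; [rewrite invr_gt0|exists u].
have mRI (P : R[i] -> R) : (forall z w : R[i], `|P z - P w| <= cmod (z - w)) ->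
    (forall n, measurable_fun setT (fun x => P (u n x))) ->
    measurable_fun setT (fun x => P (f x)).
  move=> P1 mP; apply: (measurable_fun_cvg (h := fun n x => P (u n x))) => // x _.
  apply/cvgrPdist_le => e e0; near=> n.
  rewrite (le_trans (P1 _ _))// (le_trans ((hu n).2 x))//.
  near: n; apply: (filterS _ (near_infty_natSinv_lt (PosNum e0))) => n /=.
  exact: ltW.
have mf : cmeas f.
  split; apply: mRI.
  - by move=> z w; rewrite -ReN -ReD cmod_Re.
  - by move=> n; have [[]] := (L2P mu (u n)).1 (hu n).1.
  - by move=> z w; rewrite -ImN -ImD cmod_Im.
  - by move=> n; have [[]] := (L2P mu (u n)).1 (hu n).1.
have Lb : L2 mu (fun x => f x - u 0%N x).
  apply: (L2_bounded mu (M := 1)).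
    have := cmeas_lin (-1) (L2_cmeas (hu 0%N).1) mf.
    by under eq_fun do rewrite mulN1r addrC.
  by move=> x; have := (hu 0%N).2 x; rewrite invr1.
have := L2D Lb (hu 0%N).1.
by under eq_fun do rewrite subrK.
Unshelve. all: by end_near. Qed.

(* The Fubini identity for [H x y * (g y)^* * (w x)^*], in a form that needs no
   measurability of [H] on the product. *)
Definition fubini_kernel H := [/\ forall x, L2 mu (H x),
  forall y, L2 mu (H ^~ y) &
  forall g w, L2 mu g -> L2 mu w ->
  [/\ L2 mu (fun x => cinner mu (H x) g),
      L2 mu (fun y => cinner mu (H ^~ y) w) &
      cinner mu (fun x => cinner mu (H x) g) w =
      cinner mu (fun y => cinner mu (H ^~ y) w) g]].

Lemma fubini_kernel_rank1 e h : L2 mu e -> L2 mu h ->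
  fubini_kernel (fun x y => e x * h y).
Proof.
move=> Le Lh.
have LeZ y : L2 mu (fun x => e x * h y).
  by have := L2Z (h y) Le; under eq_fun do rewrite mulrC.
split => [x|y|g w Lg Lw]; [exact: L2Z|exact: LeZ|].
have -> : (fun x => cinner mu (fun y => e x * h y) g) =
    fun x => cinner mu h g * e x.
  by apply/funext => x; rewrite cinnerZl// mulrC.
have -> : (fun y => cinner mu (fun x => e x * h y) w) =
    fun y => cinner mu e w * h y.
  apply/funext => y; rewrite -[RHS]mulrC -cinnerZl//; congr (cinner mu _ w).
  by apply/funext => x; rewrite mulrC.
by split; [exact: L2Z|exact: L2Z|rewrite !cinnerZl// mulrC].
Qed.

Lemma fubini_kernel_lin a H K : fubini_kernel H -> fubini_kernel K ->
  fubini_kernel (fun x y => a * H x y + K x y).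
Proof.
move=> [Hl Hr HF] [Kl Kr KF]; split => [x|y|g w Lg Lw].
- exact: L2_lin.
- exact: (L2_lin a (Hr y) (Kr y)).
have [H1 H2 H3] := HF _ _ Lg Lw; have [K1 K2 K3] := KF _ _ Lg Lw.
have -> : (fun x => cinner mu (fun y => a * H x y + K x y) g) =
    fun x => a * cinner mu (H x) g + cinner mu (K x) g.
  by apply/funext => x; rewrite cinner_lin.
have -> : (fun y => cinner mu (fun x => a * H x y + K x y) w) =
    fun y => a * cinner mu (H ^~ y) w + cinner mu (K ^~ y) w.
  by apply/funext => y; rewrite (cinner_lin a (Hr y) (Kr y) Lw).
by split; [exact: L2_lin|exact: L2_lin|rewrite !cinner_lin// H3 K3].
Qed.

Lemma cmeas_indic (A : set T) : measurable A -> cmeas (fun x => (\1_A x)%:C : R[i]).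
Proof.
move=> mA; split => /=; [exact/measurable_indicP|exact: measurable_cst].
Qed.

Lemma cmod_indic (A : set T) x : cmod ((\1_A x)%:C : R[i]) <= 1.
Proof. by rewrite cmodr indicE; case: (x \in A); rewrite ?normr1 ?normr0. Qed.

Lemma L2_indic A : measurable A -> L2 mu (fun x => (\1_A x)%:C).
Proof.
by move=> mA; apply: (L2_bounded mu (M := 1)); [exact: cmeas_indic|exact: cmod_indic].
Qed.

Lemma L2_indicM A f : measurable A -> L2 mu f -> L2 mu (fun x => (\1_A x)%:C * f x).
Proof.
by move=> mA Lf; apply: (L2_Mb (M := 1)) => //; [exact: cmeas_indic|exact: cmod_indic].
Qed.

(** An indicator in the first variable can be moved onto the test function [w]. Kernels defined
    piecewise in [x] thus keep the exchange property. *)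
Lemma fubini_kernel_indic A H : measurable A -> fubini_kernel H ->
  fubini_kernel (fun x y => (\1_A x)%:C * H x y).
Proof.
move=> mA [Hl Hr HF].
have LA y : L2 mu (fun x => (\1_A x)%:C * H x y) by exact: (L2_indicM mA (Hr y)).
have swap f g : cinner mu (fun x => (\1_A x)%:C * f x) g =
                cinner mu f (fun x => (\1_A x)%:C * g x).
  rewrite /cinner; congr cintegral; apply/funext => x.
  rewrite conjMc -mulrA mulrCA; congr (_ * (_ * _)).
  by rewrite indicE; case: (x \in A); rewrite ?rmorph1 ?rmorph0.
split => [x|y|g w Lg Lw]; [exact: L2Z|exact: LA|].
have LAw := L2_indicM mA Lw.
have [H1 H2 H3] := HF _ _ Lg LAw; have [H1' _ _] := HF _ _ Lg Lw.
have -> : (fun x => cinner mu (fun y => (\1_A x)%:C * H x y) g) =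
    fun x => (\1_A x)%:C * cinner mu (H x) g.
  by apply/funext => x; rewrite cinnerZl.
have -> : (fun y => cinner mu (fun x => (\1_A x)%:C * H x y) w) =
    fun y => cinner mu (H ^~ y) (fun x => (\1_A x)%:C * w x).
  by apply/funext => y; rewrite swap.
by split => //; [exact: L2_indicM|rewrite swap].
Qed.

(** Uniformity over every row and every column replaces joint approximation: by Cauchy-Schwarz the
    partial inner products converge uniformly, hence stay in [L2] by [L2_unif], and both iterated
    integrals converge. *)
Lemma fubini_kernel_lim H : (forall x, L2 mu (H x)) ->
  (forall y, L2 mu (H ^~ y)) ->
  (forall e : R, 0 < e -> exists K, [/\ fubini_kernel K,
     forall x, nrm mu (fun y => H x y - K x y) <= e &
     forall y, nrm mu (fun x => H x y - K x y) <= e]) ->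
  fubini_kernel H.
Proof.
move=> Hl Hr HK; split => // g w Lg Lw.
have apprl (e : R) K h : 0 <= e -> L2 mu h -> fubini_kernel K ->
    (forall x, nrm mu (fun y => H x y - K x y) <= e) ->
    forall x, cmod (cinner mu (H x) h - cinner mu (K x) h) <= e * nrm mu h.
  move=> e0 Lh [Kl Kr _] HKe x; rewrite -cinnerBl//.
  apply: le_trans (cauchy_schwarz (L2B (Hl x) (Kl x)) Lh) _.
  by rewrite ler_wpM2r// nrm_ge0.
have apprr (e : R) K h : 0 <= e -> L2 mu h -> fubini_kernel K ->
    (forall y, nrm mu (fun x => H x y - K x y) <= e) ->
    forall y, cmod (cinner mu (H ^~ y) h - cinner mu (K ^~ y) h) <= e * nrm mu h.
  move=> e0 Lh [Kl Kr _] HKe y; rewrite -(cinnerBl (Hr y) (Kr y) Lh).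
  apply: le_trans (cauchy_schwarz (L2B (Hr y) (Kr y)) Lh) _.
  by rewrite ler_wpM2r// nrm_ge0.
have pos h : 0 < nrm mu h + 1 by rewrite ltr_wpDl// nrm_ge0.
have small (e : R) h : 0 < e -> e / (nrm mu h + 1) * nrm mu h <= e.
  by move=> e0; rewrite mulrAC ler_pdivrMr// ler_pM2l// lerDl.
have LA : L2 mu (fun x => cinner mu (H x) g).
  apply: L2_unif => e e0; have e1 : 0 < e / (nrm mu g + 1) by rewrite divr_gt0.
  have [K [gK HKl HKr]] := HK _ e1; have [_ _ KF] := gK.
  have [K1 _ _] := KF _ _ Lg Lw; exists (fun x => cinner mu (K x) g) => // x.
  exact: le_trans (apprl _ _ _ (ltW e1) Lg gK HKl x) (small _ _ e0).
have LB : L2 mu (fun y => cinner mu (H ^~ y) w).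
  apply: L2_unif => e e0; have e1 : 0 < e / (nrm mu w + 1) by rewrite divr_gt0.
  have [K [gK HKl HKr]] := HK _ e1; have [_ _ KF] := gK.
  have [_ K2 _] := KF _ _ Lg Lw; exists (fun y => cinner mu (K ^~ y) w) => // y.
  exact: le_trans (apprr _ _ _ (ltW e1) Lw gK HKr y) (small _ _ e0).
split => //; apply/eqP; rewrite -subr_eq0; apply/eqP/cmod_eq0/eqP.
rewrite eq_le cmod_ge0 andbT; apply/ler_addgt0Pl => e e0; rewrite addr0.
pose M := 2 * (nrm mu g * nrm mu w) + 1.
have M0 : 0 < M by rewrite ltr_wpDl// !mulr_ge0// nrm_ge0.
have e1 : 0 < e / M by rewrite divr_gt0.
have [K [gK HKl HKr]] := HK _ e1; have [_ _ KF] := gK.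
have [K1 K2 K3] := KF _ _ Lg Lw.
have -> : cinner mu (fun x => cinner mu (H x) g) w -
    cinner mu (fun y => cinner mu (H^~ y) w) g =
    cinner mu (fun x => cinner mu (H x) g - cinner mu (K x) g) w -
    cinner mu (fun y => cinner mu (H^~ y) w - cinner mu (K^~ y) w) g.
  by rewrite (cinnerBl LA K1 Lw) (cinnerBl LB K2 Lg) K3 opprB addrA subrK.
apply: le_trans (cmodD _ _) _; rewrite cmodN.
have b1 := cauchy_schwarz (L2B LA K1) Lw.
have b2 := cauchy_schwarz (L2B LB K2) Lg.
have b3 := nrm_le_bound mu (L2_cmeas (L2B LA K1)) (apprl _ _ _ (ltW e1) Lg gK HKl).
have b4 := nrm_le_bound mu (L2_cmeas (L2B LB K2)) (apprr _ _ _ (ltW e1) Lw gK HKr).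
apply: le_trans (lerD b1 b2) _.
apply: le_trans (lerD (ler_wpM2r (nrm_ge0 _ _) b3) (ler_wpM2r (nrm_ge0 _ _) b4)) _.
have -> : e / M * nrm mu g * nrm mu w + e / M * nrm mu w * nrm mu g =
    e / M * (2 * (nrm mu g * nrm mu w)) by ring.
by rewrite mulrAC ler_pdivrMr// ler_pM2l// lerDl.
Qed.

End Kernels.

(** * Measure-preserving changes of variable *)

Section MeasurePreserving.
Context {d} {T : measurableType d} {R : realType} (mu : probability T R).
Local Open Scope complex_scope.
Implicit Types (f g : T -> R[i]).

Definition mpreserving (phi : T -> T) := measurable_fun setT phi /\
  forall A, measurable A -> mu (phi @^-1` A) = mu A.

Variable phi : T -> T.
Hypothesis mphi : mpreserving phi.

Lemma mpreserving_ge0_integral (u : T -> \bar R) : measurable_fun setT u ->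
  (forall x, (0 <= u x)%E) -> (\int[mu]_x u (phi x) = \int[mu]_x u x)%E.
Proof.
move=> mu_ u0; have [mp pm] := mphi.
have := @ge0_integral_pushforward _ _ _ _ _ _ mp mu setT u measurableT mu_.
rewrite preimage_setT => <-; last by move=> x _; exact: u0.
apply: eq_measure_integral => A mA _; exact: pm.
Qed.

Lemma mpreserving_Rintegral (u : T -> R) : measurable_fun setT u ->
  \int[mu]_x u (phi x) = \int[mu]_x u x.
Proof.
move=> mu_; rewrite /Rintegral; congr fine.
have mue : measurable_fun setT (EFin \o u) by exact/measurable_EFinP.
rewrite integralE [RHS]integralE.
have -> : (fun x => (u (phi x))%:E)^\+%E = ((EFin \o u)^\+ \o phi)%E.
  by apply/funext => x; rewrite -funepos_comp.
have -> : (fun x => (u (phi x))%:E)^\-%E = ((EFin \o u)^\- \o phi)%E.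
  by apply/funext => x; rewrite -funeneg_comp.
congr (_ - _)%E.
  exact: (mpreserving_ge0_integral (measurable_funepos mue) (funepos_ge0 _)).
exact: (mpreserving_ge0_integral (measurable_funeneg mue) (funeneg_ge0 _)).
Qed.

Lemma mpreserving_cmeas f : cmeas f -> cmeas (f \o phi).
Proof.
have [mp _] := mphi.
by move=> [m1 m2]; split; [exact: (measurableT_comp m1)|exact: (measurableT_comp m2)].
Qed.

Lemma mpreserving_cintegral f : cmeas f -> cintegral mu (f \o phi) = cintegral mu f.
Proof.
move=> [m1 m2]; rewrite /cintegral /=.
by rewrite (mpreserving_Rintegral m1) (mpreserving_Rintegral m2).
Qed.

Lemma mpreserving_L2 f : L2 mu f -> L2 mu (f \o phi).
Proof.
move=> /L2P[mf If]; apply/L2P; split; first exact: mpreserving_cmeas.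
have mc : measurable_fun setT (fun x => (cmod (f x) ^+ 2)%:E).
  by apply/measurable_EFinP; apply: measurable_funX; exact: cmeas_cmod.
apply/integrableP; split.
  apply/measurable_EFinP; apply: measurable_funX; apply: cmeas_cmod.
  exact: mpreserving_cmeas.
have /integrableP[_] := If.
rewrite -(@mpreserving_ge0_integral (fun x => `|(cmod (f x) ^+ 2)%:E|%E))//.
exact: measurableT_comp.
Qed.

Lemma mpreserving_cinner f g : L2 mu f -> L2 mu g ->
  cinner mu (f \o phi) (g \o phi) = cinner mu f g.
Proof.
move=> Lf Lg; rewrite /cinner.
by rewrite -(mpreserving_cintegral (cmeasM (L2_cmeas Lf) (cmeasJ (L2_cmeas Lg)))).
Qed.

Lemma mpreserving_nrm f : L2 mu f -> nrm mu (f \o phi) = nrm mu f.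
Proof.
move=> Lf; congr Num.sqrt.
have m : measurable_fun setT (fun x => cmod (f x) ^+ 2).
  by apply: measurable_funX; exact: cmeas_cmod (L2_cmeas Lf).
by rewrite -(mpreserving_Rintegral m).
Qed.

End MeasurePreserving.

(** * Continuous kernels on a compact group *)

Section ContinuousKernels.
Context {R : realType} {G : topologicalGroupType} (mu : probability (borel G) R).
Local Open Scope complex_scope.
Hypothesis cG : compact [set: G].

Lemma measurable_open (U : set G) : open U -> measurable (U : set (borel G)).
Proof. by move=> oU; exact: (@sub_sigma_algebra G setT (@open G)). Qed.

Lemma measurable_closed (U : set G) : closed U -> measurable (U : set (borel G)).
Proof.
by move=> /closed_openC/measurable_open/measurableC; rewrite setCK.
Qed.

Lemma continuous_measurable (u : G -> R) : continuous u ->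
  measurable_fun setT (u : borel G -> R).
Proof.
move=> /continuousP cu; apply: (measurability _ (RGenOpens.measurableE R)).
move=> _ [_ [a [b ->] <-]]; rewrite setTI; apply: measurable_open.
exact/cu/interval_open.
Qed.

Lemma continuous_measurable_self (phi : G -> G) : continuous phi ->
  measurable_fun setT (phi : borel G -> borel G).
Proof.
move=> /continuousP cu.
apply: (@measurability _ _ (borel G) (borel G) setT phi (@open G)) => //.
by move=> _ [U oU <-]; rewrite setTI; apply: measurable_open; exact: cu.
Qed.

Lemma continuous_L2 (u : G -> R) : continuous u ->
  L2 mu (fun x : borel G => (u x)%:C).
Proof.
move=> cu.
have mu_ : cmeas (fun x : borel G => (u x)%:C).
  by split => /=; [exact: continuous_measurable|exact: measurable_cst].
have [M [_ hM]] : bounded_set (u @` setT).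
  by apply: compact_bounded; apply: continuous_compact => //; exact: continuous_subspaceT.
apply: (@L2_bounded _ _ _ _ _ (M + 1)) => // x.
by rewrite cmodr; apply: hM; [rewrite ltrDl|exists x].
Qed.

(** By compactness, finitely many open sets [U i] cover [G] such that the row [H x] is uniformly
    within [e] of [H i] for [x] in [U i]. Replacing each row by that of the first [U i] containing
    [x] gives a finite combination of rank-one kernels cut by indicators, uniformly close to [H]. *)
Lemma continuous_fubini_kernel (H : G -> G -> R) :
  continuous (fun p : G * G => H p.1 p.2) ->
  fubini_kernel mu (fun x y : borel G => (H x y)%:C).
Proof.
move=> cH.
have cHl x : continuous (H x).
  move=> y; apply: (@continuous_comp _ _ _ (fun y => (x, y)) (fun p : G * G => H p.1 p.2)).
    by apply: cvg_pair; [exact: cvg_cst|exact: cvg_id].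
  exact: cH.
have cHr y : continuous (H ^~ y).
  move=> x; apply: (@continuous_comp _ _ _ (fun x => (x, y)) (fun p : G * G => H p.1 p.2)).
    by apply: cvg_pair; [exact: cvg_id|exact: cvg_cst].
  exact: cH.
apply: fubini_kernel_lim => [x|y|e e0].
- exact: continuous_L2.
- exact: (continuous_L2 (cHr y)).
pose U x := interior [set x' | forall y, `|H x' y - H x y| <= e].
have oU x : open (U x) by exact: open_interior.
have Ux x : U x x.
  apply: (_ : \forall x' \near x, forall y, `|H x' y - H x y| <= e).
  (* The tube lemma: continuity at each [(x, y)] is made uniform in [y] by compactness of [G]. *)
  have := (compact_near_coveringP _).1 cG G (nbhs x)
    (fun x' y => `|H x' y - H x y| <= e) _.
  move=> h; have : \forall x' \near x, [set: G] `<=` (fun y => `|H x' y - H x y| <= e).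
    apply: h => y _.
    have e2 : 0 < e / 2 by rewrite divr_gt0.
    have /cvgrPdist_lt/(_ _ e2)[[A B] /= [nA nB] AB] := cH (x, y).
    exists (B, A) => //= -[y' x'] /= [By' Ax'].
    have h1 := AB (x', y') (conj Ax' By').
    have h2 := AB (x, y') (conj (nbhs_singleton nA) By').
    rewrite /= in h1 h2; rewrite -(subrK (H x y) (H x' y')) -addrA.
    rewrite (le_trans (ler_normD _ _))// [leRHS](splitr e) lerD ?ltW//.
    by rewrite distrC.
  by apply: filterS => x' hx' y; exact: hx'.
have [s hs] : exists s : seq G, forall x, exists2 i, i \in s & U i x.
  have : @cover_compact G [set: G] by rewrite -compact_cover.
  move=> /(_ G setT U (fun i _ => oU i)).
  move=> [x _|D' _ hD']; first by exists x.
  exists (finmap.enum_fset D') => x; have [i /= iD' Uix] := hD' x I.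
  by exists i.
(* Induction on the cover: on the head set use the row of its centre, off it the kernel built from
   the tail. This makes the pieces disjoint without naming them. *)
have key (s' : seq G) : exists2 K, fubini_kernel mu K &
    forall x y, (exists2 i, i \in s' & U i x) -> cmod ((H x y)%:C - K x y) <= e.
  elim: s' => [|i s' [K gK hK]].
    exists (fun x y => 0 * 0); last by move=> x y [].
    by apply: (@fubini_kernel_rank1 _ _ _ mu (fun=> 0) (fun=> 0)); exact: L2_cst.
  pose V : set (borel G) := U i.
  have mV : measurable V by apply: measurable_open; exact: oU.
  have g1 : fubini_kernel mu (fun x y : borel G => (\1_V x)%:C * (1 * (H i y)%:C)).
    have := fubini_kernel_rank1 (L2_cst mu 1) (continuous_L2 (cHl i)).
    exact: fubini_kernel_indic mV.
  have g2 : fubini_kernel mu (fun x y => (\1_(~` V) x)%:C * K x y).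
    exact: (fubini_kernel_indic (measurableC mV) gK).
  have g3 := fubini_kernel_lin 1 g1 g2.
  eexists; first exact: g3.
  move=> x y hx /=; rewrite !mul1r.
  have [xU|xU] := pselect (V x).
    have e1 : \1_V x = 1 :> R by rewrite indicE mem_set.
    have e2 : \1_(~` V) x = 0 :> R by rewrite indicE memNset// => /(_ xU).
    rewrite e1 e2 mul1r mul0r addr0 -rmorphB cmodr.
    exact: (interior_subset xU y).
  have e1 : \1_V x = 0 :> R by rewrite indicE memNset.
  have e2 : \1_(~` V) x = 1 :> R by rewrite indicE mem_set.
  rewrite e1 e2 mul0r add0r mul1r; apply: hK.
  by case: hx => j; rewrite inE => /predU1P[->|js'] Uj //; exists j.
have [K gK hK] := key s; have [Kl Kr _] := gK; exists K; split => // [x|y].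
  apply: nrm_le_bound => [|y]; last exact: hK.
  by apply: L2_cmeas; apply: L2B => //; exact: continuous_L2.
apply: nrm_le_bound => [|x]; last exact: hK.
by apply: L2_cmeas; apply: (L2B _ (Kr y)); exact: (continuous_L2 (cHr y)).
Qed.

End ContinuousKernels.

(** * Translations and inversion on a compact group *)

Section NormOfConstants.
Context {d} {T : measurableType d} {R : realType} (mu : probability T R).

Lemma cmod1 : cmod (1 : R[i]) = 1.
Proof. by rewrite cmodE /= expr1n expr0n addr0 sqrtr1. Qed.

Lemma nrm_cst (a : R[i]) : nrm mu (fun=> a) = cmod a.
Proof.
rewrite /nrm Rintegral_cst//; have /(congr1 fine) /= -> := probability_setT mu.
by rewrite mulr1 sqrtr_sqr ger0_norm// cmod_ge0.
Qed.

End NormOfConstants.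

Section HaarTranslations.
Context {R : realType} {G : topologicalGroupType} (mu : probability (borel G) R).
Local Notation Re := complex.Re.
Local Open Scope complex_scope.
Hypothesis cG : compact [set: G].
Hypothesis hG : hausdorff_space G.
Hypothesis hmu : haar mu.

Lemma continuous_lmul (g : G) : continuous (fun x : G => (g * x)%g).
Proof.
move=> x; apply: (@continuous_comp _ _ _ (fun x => (g, x)) (fun p : G * G => (p.1 * p.2)%g)).
  by apply: cvg_pair; [exact: cvg_cst|exact: cvg_id].
exact: mulg_continuous.
Qed.

Lemma mpreserving_lmul (g : G) : mpreserving mu (fun x : borel G => (g * x)%g).
Proof.
split; first exact: (continuous_measurable_self (@continuous_lmul g)).
by move=> A mA; have [h _ _] := hmu; exact: h.
Qed.

Lemma continuous_divg : continuous (fun p : G * G => (p.1^-1 * p.2)%g).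
Proof.
move=> p; apply: (@continuous_comp _ _ _ (fun p : G * G => (p.1^-1, p.2)%g)
  (fun p : G * G => (p.1 * p.2)%g)); last exact: mulg_continuous.
apply: cvg_pair; last exact: cvg_snd.
apply: (@continuous_comp _ _ _ fst (fun x : G => x^-1%g)); first exact: cvg_fst.
exact: invg_continuous.
Qed.

(** Exchange the integrals of [u (x^-1 y)]. For fixed [x], left invariance gives the integral of
    [u]; for fixed [y], writing [x^-1 y] as the inverse of [y^-1 x] gives the integral of [u]
    composed with inversion. *)
Lemma cinner_inv_continuous (u : G -> R) : continuous u ->
  cinner mu (fun x : borel G => (u x^-1%g)%:C) (fun=> 1) =
  cinner mu (fun x : borel G => (u x)%:C) (fun=> 1).
Proof.
move=> cu.
have cui : continuous (fun x : G => u x^-1%g).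
  by move=> x; apply: (@continuous_comp _ _ _ (fun x : G => x^-1%g) u);
    [exact: invg_continuous|exact: cu].
have cuH : continuous (fun p : G * G => u (p.1^-1 * p.2)%g).
  by move=> x; apply: (@continuous_comp _ _ _ (fun p : G * G => (p.1^-1 * p.2)%g) u); [exact: continuous_divg|exact: cu].
have Lu := continuous_L2 mu cG cu; have Lui := continuous_L2 mu cG cui.
have L1 := L2_cst mu (1 : R[i]).
have [_ _ /(_ _ _ L1 L1)[_ _]] :=
  continuous_fubini_kernel mu cG (H := fun x y => u (x^-1 * y)%g) cuH.
have c11 : cinner mu (fun=> 1) (fun=> 1) = 1.
  by rewrite cinner_nrm nrm_cst cmod1 expr1n.
have -> : (fun x => cinner mu (fun y : borel G => (u (x^-1 * y)%g)%:C) (fun=> 1)) =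
    fun x : borel G => cinner mu (fun y => (u y)%:C) (fun=> 1) * 1.
  apply/funext => x; rewrite mulr1.
  by rewrite -(mpreserving_cinner (mpreserving_lmul x^-1%g) Lu L1).
have -> : (fun y => cinner mu (fun x : borel G => (u (x^-1 * y)%g)%:C) (fun=> 1)) =
    fun y : borel G => cinner mu (fun x => (u x^-1%g)%:C) (fun=> 1) * 1.
  apply/funext => y; rewrite mulr1.
  rewrite -(mpreserving_cinner (mpreserving_lmul y^-1%g) Lui L1).
  by congr (cinner mu _ _); apply/funext => x /=; rewrite invgM invgK.
by rewrite !cinnerZl// c11 !mulr1.
Qed.

Lemma integral_inv_continuous (u : G -> R) : continuous u -> (forall x, 0 <= u x) ->
  (\int[mu]_(x in [set: borel G]) (u x^-1%g)%:E =
   \int[mu]_(x in [set: borel G]) (u x)%:E)%E.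
Proof.
move=> cu u0.
have cui : continuous (fun x : G => u x^-1%g).
  by move=> x; apply: (@continuous_comp _ _ _ (fun x : G => x^-1%g) u);
    [exact: invg_continuous|exact: cu].
have h (v : G -> R) : continuous v ->
    (\int[mu]_(x in [set: borel G]) (v x)%:E =
     (Re (cinner mu (fun x : borel G => (v x)%:C) (fun=> 1)))%:E)%E.
  move=> cv; have [i1 _] := L2_cintegrable (continuous_L2 mu cG cv) (L2_cst mu (1 : R[i])).
  have e x : Re ((v x)%:C * Num.conj (1 : R[i])) = v x by rewrite rmorph1 mulr1.
  transitivity ((\int[mu]_x v x)%:E).
    rewrite /Rintegral fineK//.
    apply: integrable_fin_num => //; apply: eq_integrable i1 => // x _.
    by rewrite [RHS]/= -e.
  by congr EFin; apply: eq_Rintegral => x _; rewrite e.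
by rewrite !h// cinner_inv_continuous.
Qed.

Lemma urysohn_compact_open (K U : set G) : compact K -> open U -> K `<=` U ->
  exists h : G -> R, [/\ continuous h, forall x, 0 <= h x <= 1,
    forall x, K x -> h x = 1 & forall x, ~ U x -> h x = 0].
Proof.
move=> cK oU KU; have clK := compact_closed hG cK.
have clU := open_closedC oU.
have sep : uniform_separator (~` U) K.
  have ns := (normal_separatorP (R := R)).1 (compact_normal hG cG).
  by apply: (ns _ _ clU clK); rewrite -subset0 => x [] /[swap] /KU.
exists (@Urysohn _ R (~` U) K); split.
- exact: Urysohn_continuous.
- by move=> x; have := @Urysohn_range _ R (~` U) K _ (ex_intro2 _ _ x I erefl);
    rewrite /= in_itv.
- by move=> x Kx; exact: (@Urysohn_sub1 _ R _ _ sep _ (ex_intro2 _ _ x Kx erefl)).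
- by move=> x Ux; exact: (@Urysohn_sub0 _ R _ _ sep _ (ex_intro2 _ _ x Ux erefl)).
Qed.

Lemma measurable_invg : measurable_fun setT (fun x : borel G => x^-1%g : borel G).
Proof. exact: (continuous_measurable_self (@invg_continuous G)). Qed.

Lemma measurable_preimage_inv (A : set (borel G)) : measurable A ->
  measurable [set x : borel G | A x^-1%g].
Proof.
move=> mA; rewrite -[X in measurable X]setTI.
by have := @measurable_invg measurableT A mA.
Qed.

(** For compact [K] in [U], a Urysohn function [h] lies between the two indicators, and the integral
    of [h] is unchanged by inversion; inner regularity concludes. The reverse inequality is this one
    applied to the inverse of [U]. *)
Lemma measure_inv_open_le (U : set G) : open U ->
  (mu U <= mu [set x : borel G | U x^-1%g])%E.
Proof.
move=> oU; have [_ _ reg] := hmu; rewrite (reg U oU).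
apply: ge_ereal_sup => _ [K [cK KU] <-].
have [h [ch h01 hK hU]] := urysohn_compact_open cK oU KU.
have h0 x : 0 <= h x by have /andP[] := h01 x.
have h1 x : h x <= 1 by have /andP[] := h01 x.
have mK : measurable (K : set (borel G)).
  by apply: measurable_closed; exact: compact_closed.
have mU : measurable (U : set (borel G)) by exact: measurable_open.
have mUi := measurable_preimage_inv mU.
have mh := continuous_measurable ch.
apply: (@le_trans _ _ (\int[mu]_(x in [set: borel G]) (h x)%:E)%E).
  rewrite -(setIT (K : set (borel G))) -integral_indic//.
  apply: ge0_le_integral => //.
  - by apply/measurable_EFinP; exact/measurable_indicP.
  - exact/measurable_EFinP.
  - move=> x _; rewrite lee_fin indicE; have [Kx|Kx] := pselect (K x).
      by rewrite mem_set// hK.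
    by rewrite memNset.
rewrite -integral_inv_continuous// -(setIT [set x : borel G | U x^-1%g]).
rewrite -integral_indic//; apply: ge0_le_integral => //.
- by move=> x _; rewrite lee_fin.
- apply/measurable_EFinP.
  exact: (measurableT_comp mh measurable_invg).
- by apply/measurable_EFinP; exact/measurable_indicP.
- move=> x _; rewrite lee_fin indicE; have [Kx|Kx] := pselect (U x^-1%g).
    by rewrite mem_set.
  by rewrite memNset// hU.
Qed.

Lemma open_inv (U : set G) : open U -> open [set x : G | U x^-1%g].
Proof.
by move=> oU; have /continuousP := @invg_continuous G; exact.
Qed.

(** Outer regularity extends the case of open sets to one inequality for all Borel sets; applied to
    the inverse of [A], it gives the other. *)
Lemma mpreserving_inv : mpreserving mu (fun x : borel G => x^-1%g : borel G).
Proof.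
split; first exact: measurable_invg.
have invK (A : set (borel G)) : [set x : borel G | [set x : borel G | A x^-1%g] x^-1%g] = A.
  by apply/seteqP; split => x /=; rewrite invgK.
have opn (U : set G) : open U -> mu [set x : borel G | U x^-1%g] = mu U.
  move=> oU; apply/eqP; rewrite eq_le measure_inv_open_le// andbT.
  by have := measure_inv_open_le (open_inv oU); rewrite invK.
have mi (A : set (borel G)) : measurable A -> measurable [set x : borel G | A x^-1%g].
  exact: measurable_preimage_inv.
have le (A : set (borel G)) : measurable A -> (mu [set x : borel G | A x^-1%g] <= mu A)%E.
  move=> mA; have [_ reg _] := hmu; rewrite (reg A mA).
  apply: le_ereal_inf_tmp => _ [U [oU AU] <-]; rewrite -(opn U oU).
  have mU := measurable_open oU.
  by apply: (le_measure mu (mem_set (mi _ mA)) (mem_set (mi _ mU))) => x /AU.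
move=> A mA; apply/eqP; rewrite eq_le le//=.
by have := le _ (mi _ mA); rewrite invK.
Qed.

(** Right translation by [g] is left translation by [g^-1] conjugated by inversion. *)
Lemma mpreserving_rmul (g : G) : mpreserving mu (fun x : borel G => (x * g)%g).
Proof.
have [m1 p1] := mpreserving_inv; have [m2 p2] := mpreserving_lmul g^-1%g.
have e : (fun x : borel G => (x * g)%g) =
    (fun x : borel G => ((g^-1 * x^-1)^-1)%g : borel G).
  by apply/funext => x; rewrite invgM !invgK.
split; first by rewrite e; exact: (measurableT_comp m1 (measurableT_comp m2 m1)).
move=> A mA; have mA1 := measurable_preimage_inv mA.
have mA2 : measurable [set x : borel G | A ((g^-1 * x)^-1)%g].
  by have := m2 measurableT _ mA1; rewrite setTI.
by rewrite e -[RHS]p1// -[RHS]p2// -[RHS]p1.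
Qed.

End HaarTranslations.

(** * Convolution operators *)

Section Convolution.
Context {R : realType} {G : topologicalGroupType} (mu : probability (borel G) R).
Local Open Scope complex_scope.
Local Notation "z ^*" := (Num.conj z) : complex_scope.
Hypothesis cG : compact [set: G].
Hypothesis hG : hausdorff_space G.
Hypothesis hmu : haar mu.
Implicit Types (f g v w : borel G -> R[i]).

Lemma nrm_le_measure (D : set (borel G)) f : measurable D -> cmeas f ->
  (forall x, D x -> cmod (f x) <= 1) -> (forall x, ~ D x -> f x = 0) ->
  ((nrm mu f ^+ 2)%:E <= mu D)%E.
Proof.
move=> mD mf f1 f0.
have fi x : cmod (f x) ^+ 2 <= \1_D x.
  rewrite indicE; have [Dx|Dx] := pselect (D x).
    by rewrite mem_set// exprn_ile1// ?cmod_ge0// f1.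
  by rewrite memNset// f0// cmod0 expr0n.
have mc : measurable_fun setT (fun x => (cmod (f x) ^+ 2)%:E).
  by apply/measurable_EFinP; apply: measurable_funX; exact: cmeas_cmod.
have Lf : L2 mu f.
  apply: (L2_bounded mu (M := 1) mf) => x.
  have [Dx|Dx] := pselect (D x); first exact: f1.
  by rewrite f0// cmod0.
rewrite nrm_sqr /Rintegral fineK; last exact: integrable_fin_num (L2_sqr Lf).
rewrite -(setIT D) -integral_indic//; apply: ge0_le_integral => //.
- by move=> x _; rewrite lee_fin sqr_ge0.
- by apply/measurable_EFinP; exact/measurable_indicP.
- by move=> x _; rewrite lee_fin.
Qed.

Lemma mu_fin (A : set (borel G)) : measurable A -> mu A \is a fin_num.
Proof. by move=> mA; exact: fin_num_measure. Qed.

Lemma nrm_indicB (A B : set (borel G)) (e : R) : measurable A -> measurable B ->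
  A `<=` B -> 0 <= e -> (mu B <= mu A + (e ^+ 2)%:E)%E ->
  nrm mu (fun x => (\1_B x)%:C - (\1_A x)%:C) <= e.
Proof.
move=> mA mB AB e0 AeB.
have mBA : measurable (B `\` A) by exact: measurableD.
rewrite -(@ler_pXn2r _ 2) ?nnegrE ?nrm_ge0// -lee_fin.
apply: (@le_trans _ _ (mu (B `\` A))).
  apply: nrm_le_measure => //.
  - by apply: (@L2_cmeas _ _ _ mu); apply: L2B; exact: L2_indic.
  - move=> x [Bx Ax]; rewrite !indicE mem_set// memNset// subr0.
    by rewrite cmod1.
  - move=> x BAx; rewrite !indicE; have [Bx|Bx] := pselect (B x).
      have Ax : A x by apply: contrapT => Ax; apply: BAx.
      by rewrite !mem_set// subrr.
    by rewrite !memNset ?subrr// => /AB.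
rewrite measureD//; last by rewrite ltey_eq mu_fin.
have -> : B `&` A = A by rewrite setIidr.
by rewrite leeBlDl// mu_fin.
Qed.

(** Density of continuous functions. Outer regularity approximates a Borel set by an open [U]; inner
    regularity and a Urysohn function approximate the indicator of [U], with an error at most 1
    supported on [U] minus [K]. *)
Lemma haar_L2_ind (Phi : set (borel G -> R[i])) : lin_closed Phi ->
  L2_lim_closed mu Phi ->
  (forall u : G -> R, continuous u -> Phi (fun x => (u x)%:C)) ->
  forall f, L2 mu f -> Phi f.
Proof.
move=> Plin Plim Pc; have [_ outer inner] := hmu.
have Popen (U : set G) : open U -> Phi (fun x : borel G => (\1_(U : set (borel G)) x)%:C).
  move=> oU; have mU := measurable_open oU.
  apply: Plim => [|e e0]; first exact: L2_indic.
  have e20 : 0 < e ^+ 2 by rewrite exprn_gt0.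
  have fU : ereal_sup [set mu K | K in [set K : set G | compact K /\ K `<=` U]]
      \is a fin_num by rewrite -inner// mu_fin.
  have [_ [K [cK KU] <-] hK] := ub_ereal_sup_adherent e20 fU.
  have mK : measurable (K : set (borel G)).
    by apply: measurable_closed; exact: compact_closed.
  have [h [ch h01 h1 h0]] := urysohn_compact_open (R := R) cG hG cK oU KU.
  exists (fun x => (h x)%:C); split; [exact: Pc|exact: continuous_L2|].
  have mh : cmeas (fun x : borel G => (\1_(U : set (borel G)) x)%:C - (h x)%:C : R[i]).
    by apply: (@L2_cmeas _ _ _ mu); apply: L2B; [exact: L2_indic|exact: continuous_L2].
  rewrite -(@ler_pXn2r _ 2) ?nnegrE ?nrm_ge0 ?(ltW e0)// -lee_fin.
  have mUK : measurable ((U : set (borel G)) `\` (K : set (borel G))) by exact: measurableD.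
  apply: le_trans (nrm_le_measure mUK mh _ _) _.
  - move=> x _; rewrite -rmorphB cmodr indicE.
    have /andP[hx0 hx1] := h01 x; rewrite ler_norml.
    by case: (x \in _) => /=; lra.
  - move=> x /= UKx; rewrite indicE; have [Ux|Ux] := pselect (U x).
      have Kx : K x by apply: contrapT => Kx; apply: UKx.
      by rewrite mem_set// h1// subrr.
    by rewrite memNset// h0// subrr.
  rewrite measureD//; last by rewrite ltey_eq mu_fin.
  have -> : (U : set (borel G)) `&` K = K by rewrite setIidr.
  rewrite leeBlDl ?mu_fin//; apply: ltW.
  by move: hK; rewrite -inner// lteBlDr.
apply: L2_ind => // A mA; apply: Plim => [|e e0]; first exact: L2_indic.
have e20 : 0 < e ^+ 2 by rewrite exprn_gt0.
have fA : ereal_inf [set mu U | U in [set U : set G | open U /\ A `<=` U]]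
    \is a fin_num by rewrite -outer// mu_fin.
have [_ [U [oU AU] <-] hU] := lb_ereal_inf_adherent e20 fA.
have mU := measurable_open oU.
exists (fun x => (\1_(U : set (borel G)) x)%:C); split; [exact: Popen|exact: L2_indic|].
rewrite nrmBC; apply: nrm_indicB => //; first exact: ltW.
by rewrite (outer A mA); exact: ltW.
Qed.

(** Left and right translations preserve [mu], so all rows and columns of the kernel of [f - u] have
    exactly the norm of [f - u]. Approximation in [L2] is therefore already the uniform
    approximation that [fubini_kernel_lim] requires. *)
Lemma translation_kernel v : L2 mu v ->
  fubini_kernel mu (fun x y : borel G => v (x * y)%g).
Proof.
move: v; apply: haar_L2_ind.
- move=> a f g; exact: fubini_kernel_lin.
- move=> f Lf happ; apply: fubini_kernel_lim.
  + by move=> x; exact: (mpreserving_L2 (mpreserving_lmul hmu x) Lf).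
  + by move=> y; exact: (mpreserving_L2 (mpreserving_rmul cG hG hmu y) Lf).
  + move=> e e0; have [u [Tu Lu fu]] := happ e e0.
    exists (fun x y => u (x * y)%g); split => // [x|y].
      by have := mpreserving_nrm (mpreserving_lmul hmu x) (L2B Lf Lu); move=> /= ->.
    by have := mpreserving_nrm (mpreserving_rmul cG hG hmu y) (L2B Lf Lu); move=> /= ->.
- move=> u cu; apply: (continuous_fubini_kernel mu cG (H := fun x y => u (x * y)%g)).
  move=> x; apply: (@continuous_comp _ _ _ (fun p : G * G => (p.1 * p.2)%g) u).
    exact: mulg_continuous.
  exact: cu.
Qed.

(** The operator [S_g] applied to [v]: linear in [v], conjugate-linear in [g]. *)
Definition conv g v : borel G -> R[i] :=
  fun x => cinner mu (fun y => v (x * y)%g) g.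

Lemma convE g v x : conv g v x = cinner mu (fun y => v (x * y)%g) g.
Proof. by []. Qed.

Lemma L2_lmul (z : G) v : L2 mu v -> L2 mu (fun x => v (z * x)%g).
Proof. exact: (mpreserving_L2 (mpreserving_lmul hmu z)). Qed.

Lemma L2_rmul (z : G) v : L2 mu v -> L2 mu (fun x => v (x * z)%g).
Proof. exact: (mpreserving_L2 (mpreserving_rmul cG hG hmu z)). Qed.

Lemma nrm_lmul (z : G) v : L2 mu v -> nrm mu (fun x => v (z * x)%g) = nrm mu v.
Proof. exact: (mpreserving_nrm (mpreserving_lmul hmu z)). Qed.

Lemma cinner_lmul (z : G) v w : L2 mu v -> L2 mu w ->
  cinner mu (fun x => v (z * x)%g) (fun x => w (z * x)%g) = cinner mu v w.
Proof. exact: (mpreserving_cinner (mpreserving_lmul hmu z)). Qed.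

Lemma conv_L2 g v : L2 mu g -> L2 mu v -> L2 mu (conv g v).
Proof.
by move=> Lg Lv; have [_ _ /(_ _ _ Lg Lg)[]] := translation_kernel Lv.
Qed.

Lemma conv_lin g (a : R[i]) v w : L2 mu g -> L2 mu v -> L2 mu w ->
  conv g (fun x => a * v x + w x) = fun x => a * conv g v x + conv g w x.
Proof.
move=> Lg Lv Lw; apply/funext => x.
by rewrite /conv (cinner_lin a (L2_lmul x Lv) (L2_lmul x Lw)).
Qed.

Lemma cmod_conv g v x : L2 mu g -> L2 mu v ->
  cmod (conv g v x) <= nrm mu v * nrm mu g.
Proof.
move=> Lg Lv; apply: le_trans (cauchy_schwarz (L2_lmul x Lv) Lg) _.
by rewrite nrm_lmul.
Qed.

Lemma nrm_conv g v : L2 mu g -> L2 mu v -> nrm mu (conv g v) <= nrm mu v * nrm mu g.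
Proof.
move=> Lg Lv; apply: nrm_le_bound; first exact: L2_cmeas (conv_L2 Lg Lv).
by move=> x; exact: cmod_conv.
Qed.

Lemma conv_lmul g v (z : G) :
  conv g (fun x => v (z * x)%g) = fun x => conv g v (z * x)%g.
Proof.
apply/funext => x; rewrite /conv; congr (cinner mu _ g).
by apply/funext => y; rewrite mulgA.
Qed.

Definition starg g : borel G -> R[i] := fun x => (g x^-1%g)^*.

Lemma L2_starg g : L2 mu g -> L2 mu (starg g).
Proof.
by move=> Lg; exact: L2J (mpreserving_L2 (mpreserving_inv cG hG hmu) Lg).
Qed.

Lemma nrm_starg g : L2 mu g -> nrm mu (starg g) = nrm mu g.
Proof.
move=> Lg; rewrite -(mpreserving_nrm (mpreserving_inv cG hG hmu) Lg).
by apply: eq_nrm => x; rewrite cmodJ.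
Qed.

(** After exchanging the integrals, right translation by [y^-1] moves [y] from [v] to [w], and
    inversion of [y] turns [g] into [starg g]. *)
Lemma conv_adj g v w : L2 mu g -> L2 mu v -> L2 mu w ->
  cinner mu (conv g v) w = cinner mu v (conv (starg g) w).
Proof.
move=> Lg Lv Lw; have Lh := L2_starg Lg.
have [_ _ /(_ _ _ Lg Lw)[_ _ Fv]] := translation_kernel Lv.
have [_ _ /(_ _ _ Lh Lv)[_ Lk Fw]] := translation_kernel Lw.
rewrite [RHS](cinnerC (conv_L2 Lh Lw) Lv) /conv Fv Fw.
set k := (fun y => cinner mu (fun x : borel G => w (x * y)%g) v) in Lk *.
have -> : (fun y => cinner mu (fun x : borel G => v (x * y)%g) w) =
    (fun y => (k y^-1%g)^*).
  apply/funext => y; rewrite /k -cinnerC//; last exact: L2_rmul.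
  rewrite -(mpreserving_cinner (mpreserving_rmul cG hG hmu y) Lv (L2_rmul y^-1%g Lw)).
  by congr (cinner mu _ _); apply/funext => x /=; rewrite mulgK.
rewrite -cinnerC//.
rewrite -[RHS](mpreserving_cinner (mpreserving_inv cG hG hmu) Lh Lk).
rewrite /cinner; congr cintegral; apply/funext => x /=.
by rewrite /starg invgK mulrC.
Qed.

(** [conv g v] is an average of right translates of [v], all of which stay in [V]; the exchange of
    integrals makes this precise against a test function [w]. *)
Lemma conv_orth (V : set (borel G -> R[i])) g v w :
  right_invariant V -> L2 mu g -> L2 mu v -> L2 mu w -> V v ->
  (forall h, V h -> cinner mu h w = 0) -> cinner mu (conv g v) w = 0.
Proof.
move=> rV Lg Lv Lw Vv Vw.
have [_ _ /(_ _ _ Lg Lw)[_ _ Fv]] := translation_kernel Lv.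
rewrite /conv Fv.
rewrite -[RHS](cinner0l mu g); congr (cinner mu _ g).
by apply/funext => y; rewrite Vw//; exact: rV.
Qed.

End Convolution.

(** * Eigenfunctions of [S^* S] *)

Section UniformLimit.
Context {R : realType} {T : Type}.
Local Notation Re := complex.Re.
Local Notation Im := complex.Im.
Local Open Scope complex_scope.

(** The limit is taken pointwise in the real and imaginary parts. With [L2_unif] this yields limits
    in [L2] of uniformly Cauchy sequences, so completeness of [L2] is never invoked. *)
Lemma unif_cauchy_lim (u : nat -> T -> R[i]) :
  (forall e : R, 0 < e -> exists N, forall i j x, (N <= i)%N -> (N <= j)%N ->
     cmod (u i x - u j x) <= e) ->
  exists l : T -> R[i], forall e : R, 0 < e -> exists N, forall i x,
     (N <= i)%N -> cmod (u i x - l x) <= e.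
Proof.
move=> uC.
have cv (F : R[i] -> R) x : (forall z w : R[i], `|F z - F w| <= cmod (z - w)) ->
    cvgn (fun n => F (u n x)).
  move=> FL; apply: cauchy_cvg; apply: cauchy_exP => e e0.
  have e2 : 0 < e / 2 by rewrite divr_gt0.
  have [N hN] := uC _ e2; exists (F (u N x)); exists N => // j /= Nj.
  rewrite /ball /= (le_lt_trans (FL _ _))// (le_lt_trans (hN _ _ x _ Nj))//.
  by rewrite ltr_pdivrMr// ltr_pMr// ltr1n.
have ReL (z w : R[i]) : `|Re z - Re w| <= cmod (z - w) by rewrite -ReN -ReD cmod_Re.
have ImL (z w : R[i]) : `|Im z - Im w| <= cmod (z - w) by rewrite -ImN -ImD cmod_Im.
exists (fun x => limn (fun n => Re (u n x)) +i* limn (fun n => Im (u n x))).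
move=> e e0; have e3 : 0 < e / 3 by rewrite divr_gt0.
have [N hN] := uC _ e3; exists N => i x Ni.
have /cvgrPdist_le/(_ _ e3)[N1 _ h1] := cv _ x ReL.
have /cvgrPdist_le/(_ _ e3)[N2 _ h2] := cv _ x ImL.
(* [N1], [N2] and so [j] depend on [x], but [j] is only an intermediate index: the bound holds from
   [N] on, which does not depend on [x]. *)
pose j := maxn N (maxn N1 N2).
have Nj : (N <= j)%N by rewrite leq_maxl.
have N1j : (N1 <= j)%N by rewrite /j !leq_max leqnn !orbT.
have N2j : (N2 <= j)%N by rewrite /j !leq_max leqnn !orbT.
set l := _ +i* _.
have -> : u i x - l = (u i x - u j x) + (u j x - l) by ring.
apply: le_trans (cmodD _ _) _.
have -> : e = e / 3 + (e / 3 + e / 3) by field.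
apply: lerD; first exact: hN.
have -> : u j x - l = (Re (u j x - l))%:C + 'i * (Im (u j x - l))%:C.
  exact: complexE.
apply: le_trans (cmodD _ _) _; apply: lerD.
  by rewrite cmodr ReD ReN distrC; exact: (h1 j N1j).
rewrite cmodM cmodr ImD ImN distrC (_ : cmod 'i = 1) ?mul1r; first exact: (h2 j N2j).
by rewrite cmodE /= expr1n expr0n add0r sqrtr1.
Qed.

End UniformLimit.

(* Otherwise unification unfolds inner products down to integrals. *)
Opaque cinner nrm conv.

Lemma stargK {R : realType} {G : topologicalGroupType} (f : borel G -> R[i]) :
  starg (starg f) = f.
Proof. by apply/funext => x; rewrite /starg invgK conjCK. Qed.

Section EigenFunction.
Context {R : realType} {G : topologicalGroupType} (mu : probability (borel G) R).
Local Open Scope complex_scope.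
Hypothesis cG : compact [set: G].
Hypothesis hG : hausdorff_space G.
Hypothesis hmu : haar mu.
Variable f : borel G -> R[i].
Hypothesis Lf : L2 mu f.
Implicit Types (u v w : borel G -> R[i]).

Let S v := conv mu f v.
(** The operator [S^* S] for [S = conv mu f]; the adjoint has the symbol [starg f] by [conv_adj]. *)
Definition cgram v := conv mu (starg f) (conv mu f v).
Local Notation P := cgram.
Let M := nrm mu f.

Let LS v : L2 mu v -> L2 mu (S v).
Proof. exact: conv_L2. Qed.

Lemma L2_cgram v : L2 mu v -> L2 mu (P v).
Proof. by move=> Lv; exact: (conv_L2 cG hG hmu (L2_starg cG hG hmu Lf) (LS Lv)). Qed.

Lemma cgram_lin a v w : L2 mu v -> L2 mu w ->
  P (fun x => a * v x + w x) = fun x => a * P v x + P w x.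
Proof.
move=> Lv Lw; rewrite /cgram (conv_lin hmu a Lf Lv Lw).
exact: (conv_lin hmu a (L2_starg cG hG hmu Lf) (LS Lv) (LS Lw)).
Qed.

Lemma cinner_cgram v w : L2 mu v -> L2 mu w ->
  cinner mu (P v) w = cinner mu (S v) (S w).
Proof.
move=> Lv Lw; rewrite (conv_adj cG hG hmu (L2_starg cG hG hmu Lf) (LS Lv) Lw).
by rewrite stargK.
Qed.

(** The operator is smoothing: it turns closeness in [L2] into uniform closeness, which is how the
    limit in the power iteration is obtained. *)
Lemma cmod_cgram v x : L2 mu v -> cmod (P v x) <= M ^+ 2 * nrm mu v.
Proof.
move=> Lv.
have := cmod_conv hmu x (L2_starg cG hG hmu Lf) (LS Lv).
rewrite nrm_starg// => /le_trans; apply.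
have := nrm_conv cG hG hmu Lf Lv; rewrite -/(S v) -/M => h.
by rewrite (le_trans (ler_wpM2r (nrm_ge0 _ _) h))// expr2 mulrC mulrA mulrAC.
Qed.

Lemma cgram_lmul v z : P (fun x => v (z * x)%g) = fun x => P v (z * x)%g.
Proof. by rewrite /cgram !conv_lmul. Qed.

Opaque cgram.

Lemma cgram_sym v w : L2 mu v -> L2 mu w ->
  cinner mu (P v) w = cinner mu v (P w).
Proof.
move=> Lv Lw; rewrite (cinner_cgram Lv Lw).
by rewrite (cinnerC (LS Lw) (LS Lv)) -(cinner_cgram Lw Lv) -(cinnerC (L2_cgram Lw) Lv).
Qed.

Let p m := iter m P f.

Let Lp m : L2 mu (p m).
Proof. by elim: m => [|m IH]; [exact: Lf|exact: (L2_cgram IH)]. Qed.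

(** The moments [<P^k f, f>], as [ip_a] shows. Sharing the powers of [P] between both sides, with
    one [S] left on each when [k] is odd, makes them visibly nonnegative. *)
Let a k : R := if odd k then nrm mu (S (p k./2)) ^+ 2 else nrm mu (p k./2) ^+ 2.

Let ip_shift i j : cinner mu (p i) (p j) = cinner mu (p (i + j)%N) f.
Proof.
elim: j i => [|j IH] i; first by rewrite addn0.
transitivity (cinner mu (P (p i)) (p j)); first exact/esym/(cgram_sym (Lp i) (Lp j)).
by rewrite addnS -addSn; exact: (IH i.+1).
Qed.

Let ip_a k : cinner mu (p k) f = (a k)%:C.
Proof.
rewrite /a -{1}(odd_double_half k); case: (odd k); rewrite -addnn.
  rewrite add1n -addSn -ip_shift -cinner_nrm.
  exact: (cinner_cgram (Lp _) (Lp _)).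
by rewrite add0n -ip_shift cinner_nrm.
Qed.

Let ip i j : cinner mu (p i) (p j) = (a (i + j)%N)%:C.
Proof. by rewrite ip_shift ip_a. Qed.

Let ipS i j : cinner mu (S (p i)) (S (p j)) = (a (i + j).+1%N)%:C.
Proof. rewrite -(cinner_cgram (Lp i) (Lp j)); exact: (ip i.+1 j). Qed.

Let a_ge0 k : 0 <= a k.
Proof. by rewrite /a; case: odd; rewrite sqr_ge0. Qed.

(** Cauchy-Schwarz for two consecutive iterates [p j], [p j.+1] if [m] is even, and for their images
    under [S] if [m] is odd. *)
Let a_lc m : a m.+1 ^+ 2 <= a m * a m.+2.
Proof.
have cs u v (x y z : R) : L2 mu u -> L2 mu v -> cinner mu u u = x%:C ->
    cinner mu u v = y%:C -> cinner mu v v = z%:C -> 0 <= y -> y ^+ 2 <= x * z.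
  move=> Lu Lv; rewrite !cinner_nrm => /complexI <- uv /complexI <- y0.
  have := cauchy_schwarz Lu Lv; rewrite uv cmodr ger0_norm// => h.
  by rewrite -exprMn lerXn2r// nnegrE ?mulr_ge0 ?nrm_ge0.
have [om|om] := boolP (odd m).
  have e : m = (m./2 + m./2).+1 by rewrite addnn -[LHS]odd_double_half om.
  have e1 := ipS m./2 m./2; have e2 := ipS m./2 m./2.+1.
  have e3 := ipS m./2.+1 m./2.+1.
  rewrite addnS in e2; rewrite addnS addSn in e3; rewrite -e in e1 e2 e3.
  exact: (cs _ _ _ _ _ (LS (Lp _)) (LS (Lp _)) e1 e2 e3 (a_ge0 _)).
have e : m = (m./2 + m./2)%N by rewrite addnn -[LHS]odd_double_half (negbTE om).
have e1 := ip m./2 m./2; have e2 := ip m./2 m./2.+1.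
have e3 := ip m./2.+1 m./2.+1.
rewrite addnS in e2; rewrite addnS addSn in e3; rewrite -e in e1 e2 e3.
exact: (cs _ _ _ _ _ (Lp _) (Lp _) e1 e2 e3 (a_ge0 _)).
Qed.

(** This is where the group enters. The left side is the squared norm of [S (p m)], hence at most
    the square of its supremum, and [S (p m) x = <L_x (p m), f>]. As [P] is symmetric and commutes
    with [L_x], half of the powers can be moved to [f]; Cauchy-Schwarz and invariance of the norm
    then give [a m] for every [x]. *)
Let a_sq m : a (2 * m).+1%N <= a m ^+ 2.
Proof.
have -> : a (2 * m).+1%N = nrm mu (S (p m)) ^+ 2.
  by rewrite /a /= mul2n odd_double /= uphalf_double.
rewrite lerXn2r ?nnegrE ?nrm_ge0// nrm_le_bound//; first exact: L2_cmeas (LS (Lp m)).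
move=> x.
have LLp i : L2 mu (fun y => p i (x * y)%g) by exact: L2_lmul.
have shift i j : cinner mu (fun y => p (i + j)%N (x * y)%g) f =
    cinner mu (fun y => p i (x * y)%g) (p j).
  elim: j i => [|j IH] i; first by rewrite addn0.
  rewrite addnS -addSn IH.
  have -> : (fun y => p i.+1 (x * y)%g) = P (fun y => p i (x * y)%g).
    by rewrite cgram_lmul.
  exact: (cgram_sym (LLp i) (Lp j)).
rewrite /S convE.
have [om|om] := boolP (odd m).
  have e : m = (m./2.+1 + m./2)%N by rewrite addSn addnn -[LHS]odd_double_half om.
  rewrite {1}e shift.
  have -> : (fun y => p m./2.+1 (x * y)%g) = P (fun y => p m./2 (x * y)%g).
    by rewrite cgram_lmul.
  rewrite (cinner_cgram (LLp _) (Lp _)) {1}/S conv_lmul.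
  apply: le_trans (cauchy_schwarz (L2_lmul hmu x (LS (Lp m./2))) (LS (Lp m./2))) _.
  by rewrite (nrm_lmul hmu x (LS (Lp _))) /a om expr2.
have e : m = (m./2 + m./2)%N by rewrite addnn -[LHS]odd_double_half (negbTE om).
rewrite {1}e shift.
apply: le_trans (cauchy_schwarz (LLp _) (Lp _)) _.
by rewrite (nrm_lmul hmu x (Lp _)) /a (negbTE om) expr2.
Qed.

(** The normalised iterates [E k = P^k f / lam^k] have inner products [b (i + j)], where
    [b k = a k / lam^k] decreases and is at least [lam]. Convergence of [b] makes [E] Cauchy, and
    the lower bound keeps its limit away from 0. *)
Lemma cgram_eigenfunction (V : set (borel G -> R[i])) :
  closed_subspace mu V -> V f -> (forall v, V v -> V (P v)) ->
  0 < nrm mu (conv mu f f) ->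
  exists (lam : R) l, [/\ 0 < lam,
    nrm mu (conv mu f f) ^+ 2 <= lam * nrm mu f ^+ 2, V l, 0 < nrm mu l &
    nrm mu (fun x => P l x - lam%:C * l x) = 0].
Proof.
move=> cV Vf VP Sf0.
have a1 : a 1 = nrm mu (S f) ^+ 2 by [].
have a0E : a 0 = M ^+ 2 by [].
have a1_gt0 : 0 < a 1 by rewrite a1 exprn_gt0.
have a0_gt0 : 0 < a 0.
  rewrite lt_def a_ge0 andbT; apply: contraTneq a1_gt0 => a00.
  by rewrite -leNgt; have := a_sq 0; rewrite muln0 a00 expr0n.
have apos m : 0 < a m /\ 0 < a m.+1.
  elim: m => // m [am am1]; split => //.
  have := lt_le_trans (exprn_gt0 2 am1) (a_lc m).
  by rewrite pmulr_rgt0.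
have [lam [lam0 hle hge]] := log_convex_growth (fun m => (apos m).1) a_lc a_sq.
pose b k := a k / lam ^+ k.
have lamk k : 0 < lam ^+ k by rewrite exprn_gt0.
have bS k : b k.+1 <= b k.
  rewrite /b ler_pdivrMr//.
  have -> : a k / lam ^+ k * lam ^+ k.+1 = lam * a k.
    by rewrite exprS; field; rewrite gt_eqF.
  exact: hle.
have b_ni : nonincreasing_seq b by exact/nonincreasing_seqP.
have blam k : lam <= b k by rewrite /b ler_pdivlMr// -exprS.
have b_lb : has_lbound (range b) by exists lam => _ [k _ <-].
pose be := inf (range b).
have bbe k : be <= b k by apply: ge_inf => //; exists k.
have bcv : b @ \oo --> be by exact: nonincreasing_cvgn.
pose c k : R[i] := (lam ^- k)%:C.
pose E k x := c k * p k x.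
have LE k : L2 mu (E k) by exact: L2Z.
have VE k : V (E k).
  apply: (linear_setZ _ (closed_linear cV)).
  by elim: k => //= k IH; exact: VP.
have cE i j : cinner mu (E i) (E j) = (b (i + j)%N)%:C.
  rewrite (cinnerZl (c i) (Lp i) (LE j)) (cinnerZr (c j) (Lp j) (Lp i)) ip.
  rewrite /c /b exprD.
  apply: complex_ext; rewrite !ReImE /=; last by ring.
  by field; rewrite !gt_eqF.
have dE i j : nrm mu (fun x => E i x - E j x) ^+ 2 = b (i + i)%N - 2 * b (i + j)%N + b (j + j)%N.
  apply: complexI; rewrite -cinner_nrm (cinnerBl (LE i) (LE j) (L2B (LE i) (LE j))).
  rewrite (cinnerBr (LE i) (LE j) (LE i)) (cinnerBr (LE i) (LE j) (LE j)) !cE.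
  rewrite (addnC j i).
  by apply: complex_ext; rewrite !ReImE /=; ring.
have PE k : P (E k) = fun x => lam%:C * E k.+1 x.
  have -> : E k = fun x => c k * p k x + 0 by apply/funext => x; rewrite addr0.
  rewrite (cgram_lin _ (Lp k) (L2_cst mu 0)).
  have P0 : P (fun=> 0) = fun=> 0.
    have := cgram_lin (-1) (L2_cst mu 0) (L2_cst mu 0).
    have -> : (fun x : borel G => -1 * 0 + 0 : R[i]) = fun=> 0.
      by apply/funext => x; rewrite mulr0 addr0.
    by move=> h; rewrite h; apply/funext => x; rewrite mulN1r addNr.
  apply/funext => x; rewrite P0 addr0 /E mulrA /= /c; congr (_ * _).
  by rewrite -rmorphM; congr (_%:C); rewrite exprS; field; rewrite !gt_eqF.
have EC e : 0 < e -> exists N, forall i j, (N <= i)%N -> (N <= j)%N ->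
    nrm mu (fun x => E i x - E j x) <= e.
  (* For [i, j >= N] the expression in [dE] is at most [2 * (b N - be)]. *)
  move=> e0; have e2 : 0 < e ^+ 2 / 2 by rewrite divr_gt0// exprn_gt0.
  have /cvgrPdist_le/(_ _ e2)[N _ hN] := bcv; exists N => i j Ni Nj.
  rewrite -(@ler_pXn2r _ 2) ?nnegrE ?nrm_ge0 ?(ltW e0)// dE.
  have bN : b N <= be + e ^+ 2 / 2.
    have := hN N (leqnn N); rewrite distrC ger0_norm ?subr_ge0//.
    by rewrite lerBlDl.
  have bi : b (i + i)%N <= b N by apply: b_ni; lia.
  have bj : b (j + j)%N <= b N by apply: b_ni; lia.
  have := bbe (i + j)%N; lra.
have PB u v : L2 mu u -> L2 mu v ->
    (fun x => P u x - P v x) = P (fun x => u x - v x).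
  move=> Lu Lv; have -> : (fun x => u x - v x) = fun x => -1 * v x + u x.
    by apply/funext => x; rewrite mulN1r addrC.
  by rewrite cgram_lin//; apply/funext => x; rewrite mulN1r addrC.
have M2 : 0 <= M ^+ 2 by rewrite sqr_ge0.
(* The shift of index matters: [E k.+1] is [P (E k) / lam], so [cmod_cgram] upgrades the [L2] Cauchy
   property to a uniform one. *)
have [|l hl] := @unif_cauchy_lim R (borel G) (fun k => E k.+1).
  move=> e e0.
  have e1 : 0 < e * lam / (M ^+ 2 + 1) by rewrite divr_gt0 ?mulr_gt0 ?ltr_wpDl.
  have [N hN] := EC _ e1; exists N => i j x Ni Nj.
  have -> : E i.+1 x - E j.+1 x = (lam^-1)%:C * P (fun x => E i x - E j x) x.
    have -> : P (fun x => E i x - E j x) x = lam%:C * E i.+1 x - lam%:C * E j.+1 x.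
      by rewrite -(PB _ _ (LE i) (LE j)) (PE i) (PE j).
    rewrite -mulrBr mulrA -rmorphM mulVf ?gt_eqF//.
    by rewrite rmorph1 mul1r.
  rewrite cmodM cmodr ger0_norm ?invr_ge0 ?(ltW lam0)// mulrC ler_pdivrMr//.
  apply: le_trans (cmod_cgram x (L2B (LE i) (LE j))) _.
  apply: le_trans (ler_wpM2l M2 (hN i j Ni Nj)) _.
  rewrite mulrA ler_pdivrMr ?ltr_wpDl// mulrC ler_wpM2l ?mulr_ge0 ?(ltW e0) ?(ltW lam0)//.
  by rewrite lerDl.
have Ll : L2 mu l.
  apply: L2_unif => e e0; have [N hN] := hl e e0.
  by exists (E N.+1) => // x; rewrite -cmodN opprB; exact: hN.
have El e : 0 < e -> exists N, forall i, (N <= i)%N -> nrm mu (fun x => E i x - l x) <= e.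
  move=> e0; have [N hN] := hl e e0; exists N.+1 => -[//|i] Ni.
  by apply: nrm_le_bound => [|x]; [exact: L2_cmeas (L2B (LE _) Ll)|exact: hN].
exists lam, l; split => //.
- by have := hle 0; rewrite a1 a0E.
- apply: (closed_lim cV VE Ll); apply/cvgrPdist_le => e e0.
  have [N hN] := El e e0; exists N => // i Ni.
  by rewrite /= sub0r normrN ger0_norm ?nrm_ge0//; exact: hN.
- rewrite lt_def nrm_ge0 andbT; apply/eqP => l0.
  (* If [l] had norm 0, some [E N] would have squared norm at most [lam / 2], whereas that is
     [b (N + N) >= lam]. *)
  have el : 0 < lam / 2 by rewrite divr_gt0.
  have sl : 0 < Num.sqrt (lam / 2) by rewrite sqrtr_gt0.
  have [N /(_ N (leqnn N)) hN] := El _ sl.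
  have : nrm mu (E N) <= Num.sqrt (lam / 2).
    have -> : E N = fun x => (E N x - l x) + l x by apply/funext => x; rewrite subrK.
    by rewrite (le_trans (nrmD (L2B (LE N) Ll) Ll))// l0 addr0.
  move=> hE; have := lerXn2r 2 (nrm_ge0 _ _ : _ \is Num.nneg) (ltW sl : _ \is Num.nneg) hE.
  rewrite (sqr_sqrtr (ltW el)).
  have -> : nrm mu (E N) ^+ 2 = b (N + N)%N by apply: complexI; rewrite -cinner_nrm.
  have := blam (N + N)%N; lra.
- apply/eqP; rewrite eq_le nrm_ge0 andbT; apply/ler_addgt0Pl => e e0; rewrite addr0.
  have e1 : 0 < e / (M ^+ 2 + lam) by rewrite divr_gt0// ltr_wpDl.
  have [N hN] := El _ e1.
  have LP := L2_cgram Ll; have Lll := L2Z lam%:C Ll; have LPE := L2_cgram (LE N).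
  apply: le_trans (nrmB_trans LP LPE Lll) _.
  have -> : e = M ^+ 2 * (e / (M ^+ 2 + lam)) + lam * (e / (M ^+ 2 + lam)).
    by rewrite -mulrDl mulrC divfK// gt_eqF// ltr_wpDl.
  apply: lerD.
    rewrite nrmBC (PB _ _ (LE N) Ll); apply: nrm_le_bound => [|x].
      by apply: L2_cmeas; apply: L2_cgram; exact: L2B.
    apply: le_trans (cmod_cgram x (L2B (LE N) Ll)) _.
    by rewrite ler_wpM2l// hN.
  rewrite (PE N); have -> : (fun x => lam%:C * E N.+1 x - lam%:C * l x) =
      fun x => lam%:C * (E N.+1 x - l x) by apply/funext => x; rewrite mulrBr.
  rewrite nrmZ; last exact: L2B.
  by rewrite cmodr ger0_norm ?(ltW lam0)// ler_wpM2l ?(ltW lam0)// hN.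
Qed.

End EigenFunction.

(** * Dimension of eigenspaces and the bound on [conv mu f f] *)

Section QuasirandomBound.
Context {R : realType} {G : topologicalGroupType} (mu : probability (borel G) R).
Local Open Scope complex_scope.
Hypothesis cG : compact [set: G].
Hypothesis hG : hausdorff_space G.
Hypothesis hmu : haar mu.
Implicit Types (f v w : borel G -> R[i]) (V : set (borel G -> R[i])).

Lemma sum_Rintegral k (F : 'I_k -> borel G -> R) :
  (forall i, mu.-integrable setT (EFin \o F i)) ->
  mu.-integrable setT (EFin \o (fun x => \sum_(i < k) F i x)) /\
  \int[mu]_x (\sum_(i < k) F i x) = \sum_(i < k) \int[mu]_x F i x.
Proof.
move=> iF.
suff H (s : seq 'I_k) : mu.-integrable setT (EFin \o (fun x => \sum_(i <- s) F i x)) /\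
  \int[mu]_x (\sum_(i <- s) F i x) = \sum_(i <- s) \int[mu]_x F i x by exact: H.
elim: s => [|i s [IH1 IH2]].
  have -> : (fun x => \sum_(i <- [::]) F i x) = fun=> 0.
    by apply/funext => x; rewrite big_nil.
  split; first exact: integrable0.
  by rewrite big_nil Rintegral_cst// mul0r.
have -> : (fun x => \sum_(j <- i :: s) F j x) = fun x => F i x + \sum_(j <- s) F j x.
  by apply/funext => x; rewrite big_cons.
split; first exact: integrableRD.
by rewrite RintegralD// big_cons IH2.
Qed.

Lemma sum_nrm_conv f k (e : 'I_k -> borel G -> R[i]) : L2 mu f ->
  (forall i, L2 mu (e i)) -> orthonormal mu e ->
  \sum_(i < k) nrm mu (conv mu f (e i)) ^+ 2 <= nrm mu f ^+ 2.
Proof.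
move=> Lf Le oe.
have Lc i : L2 mu (conv mu f (e i)) by exact: conv_L2.
have [i1 i2] := @sum_Rintegral k (fun i x => cmod (conv mu f (e i) x) ^+ 2)
  (fun i => L2_sqr (Lc i)).
under eq_bigr do rewrite nrm_sqr.
rewrite -i2 -[leRHS]mulr1.
have /(congr1 fine) /= <- := probability_setT mu.
rewrite -Rintegral_cst//; apply: le_Rintegral => //.
  exact: finite_measure_integrable_cst.
move=> x _.
have Lx i : L2 mu (fun y => e i (x * y)%g) by exact: L2_lmul.
have ox : orthonormal mu (fun i (y : borel G) => e i (x * y)%g).
  by move=> i j; rewrite (cinner_lmul hmu x (Le i) (Le j)) oe.
apply: le_trans (bessel Lx ox Lf); rewrite le_eqVlt; apply/orP; left; apply/eqP.
by apply: eq_bigr => i _; rewrite convE (cinnerC Lf (Lx i)) cmodJ.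
Qed.

(** [V] contains its double orthogonal complement. This brings [conv g v] back into [V] after
    [conv_orth]; for the components of a grading it follows from the decomposition itself. *)
Definition biperp V := forall h, L2 mu h ->
  (forall w, L2 mu w -> (forall v, V v -> cinner mu v w = 0) ->
    cinner mu h w = 0) -> V h.

Lemma quasirandom_conv_le V (Q : R) f : closed_subspace mu V -> left_invariant V ->
  right_invariant V -> biperp V -> 0 <= Q -> subreps_dim_ge mu V Q -> V f ->
  nrm mu (conv mu f f) ^+ 2 * Q <= nrm mu f ^+ 4.
Proof.
move=> cV lV rV pV Q0 dV Vf; have Lf := closed_L2 cV Vf.
have [S0|S0] := eqVneq (nrm mu (conv mu f f)) 0.
  by rewrite S0 expr0n mul0r exprn_ge0// nrm_ge0.
have convV g v : L2 mu g -> V v -> V (conv mu g v).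
  move=> Lg Vv; have Lv := closed_L2 cV Vv.
  apply: pV => [|w Lw hw]; first exact: conv_L2.
  exact: (conv_orth cG hG hmu rV Lg Lv Lw Vv hw).
have VP v : V v -> V (cgram mu f v).
  by move=> Vv; exact: (convV _ _ (L2_starg cG hG hmu Lf) (convV _ _ Lf Vv)).
have Sgt0 : 0 < nrm mu (conv mu f f) by rewrite lt_def S0 nrm_ge0.
have [lam [l [lam0 hlam Vl l0 Pl]]] :=
  cgram_eigenfunction cG hG hmu Lf cV Vf VP Sgt0.
pose D v x := cgram mu f v x - lam%:C * v x.
(* The eigenspace for [lam], defined by a vanishing norm instead of a pointwise equation: the
   eigenfunction [l] satisfies the equation only a.e., and closedness demands stability under
   changes on null sets. *)
pose U : set (borel G -> R[i]) := [set v | V v /\ nrm mu (D v) = 0].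
have LP v : L2 mu v -> L2 mu (cgram mu f v) by exact: L2_cgram.
have LD v : L2 mu v -> L2 mu (D v).
  by move=> Lv; apply: L2B; [exact: LP|exact: L2Z].
have Dlin a v w : L2 mu v -> L2 mu w ->
    D (fun x => a * v x + w x) = fun x => a * D v x + D w x.
  have alg (y z t u s : R[i]) : a * y + z - t * (a * u + s) =
      a * (y - t * u) + (z - t * s) by ring.
  move=> Lv Lw; rewrite /D (cgram_lin cG hG hmu Lf a Lv Lw).
  by apply/funext => x; exact: alg.
have Dl : nrm mu (D l) = 0 := Pl.
have UL v : U v -> L2 mu v by move=> [Vv _]; exact: closed_L2 cV Vv.
have lV' := closed_linear cV; have [_ V0 Vlin] := lV'.
have U0 : U (fun=> 0).
  split => //; have -> : (fun=> 0 : R[i]) = (fun x : borel G => (-1) * (l x) + l x).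
    by apply/funext => x; rewrite mulN1r addNr.
  have Ll := closed_L2 cV Vl.
  rewrite (Dlin _ _ _ Ll Ll); apply/eqP; rewrite eq_le nrm_ge0 andbT.
  apply: le_trans (nrmD (L2Z _ (LD _ Ll)) (LD _ Ll)) _.
  by rewrite (nrmZ _ (LD _ Ll)) Dl mulr0 addr0.
have Ulin a v w : U v -> U w -> U (fun x => a * v x + w x).
  move=> Uv Uw; have Lv := UL _ Uv; have Lw := UL _ Uw.
  case: Uv Uw => Vv Dv [Vw Dw]; split; first exact: Vlin.
  rewrite (Dlin _ _ _ Lv Lw); apply/eqP; rewrite eq_le nrm_ge0 andbT.
  apply: le_trans (nrmD (L2Z _ (LD _ Lv)) (LD _ Lw)) _.
  by rewrite (nrmZ _ (LD _ Lv)) Dv Dw mulr0 addr0.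
have DB v w : L2 mu v -> L2 mu w -> D v = fun x => D (fun y => v y - w y) x + D w x.
  move=> Lv Lw; have -> : (fun y => v y - w y) = fun y => (-1) * w y + v y.
    by apply/funext => y; rewrite mulN1r addrC.
  by rewrite (Dlin _ _ _ Lw Lv); apply/funext => x; rewrite mulN1r addrAC addNr add0r.
have Dle v : L2 mu v -> nrm mu (D v) <= (nrm mu f ^+ 2 + lam) * nrm mu v.
  move=> Lv; have Lv2 := L2Z lam%:C Lv.
  have := nrmD (LP _ Lv) (L2Z (-1) Lv2).
  have -> : (fun x => cgram mu f v x + -1 * (lam%:C * v x)) = D v.
    by apply/funext => x; rewrite mulN1r.
  move=> /le_trans; apply; rewrite mulrDl; apply: lerD.
    by apply: nrm_le_bound => [|x]; [exact: L2_cmeas (LP _ Lv)|exact: cmod_cgram].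
  by rewrite (nrmZ _ Lv2) (nrmZ _ Lv) cmodN cmod1 mul1r cmodr ger0_norm ?(ltW lam0).
have cU : closed_subspace mu U.
  split => //.
  move=> u v Uu Lv uv.
  have uv' : (fun k => nrm mu (fun x => u k x - v x)) @ \oo --> (0 : R).
    have : cLnorm mu 2%:E (fun x => u k x - v x) @[k --> \oo] --> 0%E := uv.
    have -> : (fun k => cLnorm mu 2%:E (fun x => u k x - v x)) =
        (fun k => (nrm mu (fun x => u k x - v x))%:E).
      by apply/funext => k; rewrite cLnorm_nrm//; apply: L2B => //; exact: UL.
    by move=> /fine_cvg.
  split; first by apply: (closed_lim cV _ Lv uv') => k; have [] := Uu k.
  apply/eqP; rewrite eq_le nrm_ge0 andbT; apply/ler_addgt0Pl => e e0; rewrite addr0.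
  pose K := nrm mu f ^+ 2 + lam.
  have K0 : 0 < K by rewrite ltr_wpDl// sqr_ge0.
  have e1 : 0 < e / K by rewrite divr_gt0.
  have /cvgrPdist_le/(_ _ e1)[N _ /(_ N (leqnn N))] := uv'.
  rewrite /= sub0r normrN ger0_norm ?nrm_ge0// => hN.
  have LuN := UL _ (Uu N).
  rewrite (DB v (u N) Lv LuN).
  apply: le_trans (nrmD (LD _ (L2B Lv LuN)) (LD _ LuN)) _.
  have [_ ->] := Uu N; rewrite addr0.
  apply: le_trans (Dle _ (L2B Lv LuN)) _.
  by rewrite nrmBC -/K mulrC -ler_pdivlMr.
have lU : left_invariant U.
  move=> g v [Vv Dv]; split; first exact: lV.
  rewrite /D cgram_lmul -[RHS]Dv.
  exact: (nrm_lmul hmu g (LD _ (closed_L2 cV Vv))).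
have UV : U `<=` V by move=> v [].
have nU : nonzero mu U.
  exists l => // /(nrm_eq0P (closed_L2 cV Vl)) l00.
  by move: l0; rewrite l00 ltxx.
have : (dimension mu U <= (nrm mu f ^+ 2 / lam)%:E)%E.
  apply: ge_ereal_sup => _ [k [bb Ub lb] <-]; rewrite lee_fin ler_pdivlMr//.
  have [e [Ue oe]] := lin_indep_orthonormal (closed_linear cU) Ub lb.
  apply: le_trans (sum_nrm_conv Lf (fun i => UL _ (Ue i)) oe).
  have ei i : nrm mu (conv mu f (e i)) ^+ 2 = lam.
    have Lei := UL _ (Ue i); have [_ De] := Ue i.
    apply: complexI; rewrite -cinner_nrm -(cinner_cgram cG hG hmu Lf Lei Lei).
    have -> : cgram mu f (e i) = fun x => lam%:C * e i x + D (e i) x.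
      by apply/funext => x; rewrite /D addrC subrK.
    rewrite (cinner_lin _ Lei (LD _ Lei) Lei) oe eqxx mulr1.
    have : cmod (cinner mu (D (e i)) (e i)) <= 0.
      by apply: le_trans (cauchy_schwarz (LD _ Lei) Lei) _; rewrite De mul0r.
    move=> h; rewrite (_ : cinner mu (D (e i)) (e i) = 0) ?addr0//.
    by apply: cmod_eq0; apply/eqP; rewrite eq_le h cmod_ge0.
  by rewrite (eq_bigr (fun=> lam))// sumr_const card_ord mulr_natl.
move=> /(le_trans (dV U cU lU UV nU)); rewrite lee_fin ler_pdivlMr// => hQ.
have -> : nrm mu f ^+ 4 = nrm mu f ^+ 2 * nrm mu f ^+ 2 by rewrite -exprD.
apply: le_trans (ler_wpM2r Q0 hlam) _.
by rewrite mulrAC ler_wpM2r ?sqr_ge0// mulrC.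
Qed.

End QuasirandomBound.

(** * Graded compact groups *)

Section GradedComponents.
Context {R : realType} {G : topologicalGroupType} (mu : probability (borel G) R).
Local Open Scope complex_scope.
Hypothesis cG : compact [set: G].
Hypothesis hG : hausdorff_space G.
Hypothesis hmu : haar mu.
Variables (n : nat) (V : grading mu n).
Implicit Types (f g h w : borel G -> R[i]) (o : option 'I_(uphalf n)).

(** [None] stands for the high part, so that all components are indexed by one finite type. *)
Definition component o := if o is Some d then level V d else high V.

Lemma component_closed o : closed_subspace mu (component o).
Proof. by case: o => [d|]; [exact: level_closed|exact: high_closed]. Qed.

Lemma component_left o : left_invariant (component o).
Proof. by case: o => [d|]; [exact: level_left|exact: high_left]. Qed.

Lemma component_right o : right_invariant (component o).
Proof. by case: o => [d|]; [exact: level_right|exact: high_right]. Qed.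

Lemma component_L2 o f : component o f -> L2 mu f.
Proof. exact: closed_L2 (component_closed o). Qed.

Lemma component_orth o o' f g : o != o' -> component o f -> component o' g -> cinner mu f g = 0.
Proof.
move=> oo' of_ og; have Lf := component_L2 of_; have Lg := component_L2 og.
case: o o' oo' of_ og => [d|] [d'|] // dd' fo go.
- by apply: (level_orth (g := V) (d := d) (e := d') dd' fo go).
- exact: (level_high_orth fo go).
- by rewrite (cinnerC Lg Lf) (level_high_orth go fo) rmorph0.
Qed.

Lemma component_sum f : L2 mu f -> exists F : option 'I_(uphalf n) -> borel G -> R[i],
  (forall o, component o (F o)) /\ nrm mu (fun x => f x - \sum_o F o x) = 0.
Proof.
move=> Lf; have [fl [fh [hl hh hf]]] := grading_sum V Lf.
pose F o := if o is Some d then fl d else fh.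
have cF o : component o (F o) by case: o.
exists F; split => //; apply/nrm_eq0P.
  by apply: L2B => //; apply: L2_sum => o _; exact: component_L2 (cF o).
apply: filterS hf => x ->; rewrite (bigD1 None)//=.
rewrite (reindex_omap Some id); last by case.
apply/eqP; rewrite subr_eq0 addrC; apply/eqP; congr (_ + _).
by apply: eq_big => // i; rewrite /= eqxx.
Qed.

Variable (f : borel G -> R[i]).
Hypothesis Lf : L2 mu f.
Variable F : option 'I_(uphalf n) -> borel G -> R[i].
Hypothesis cF : forall o, component o (F o).
Hypothesis fF : nrm mu (fun x => f x - \sum_o F o x) = 0.

Let LF o : L2 mu (F o). Proof. exact: component_L2 (cF o). Qed.

Lemma nrm0_cinner g h w : L2 mu g -> L2 mu h -> L2 mu w ->
  nrm mu (fun x => g x - h x) = 0 -> cinner mu g w = cinner mu h w.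
Proof.
move=> Lg Lh Lw gh; apply/eqP; rewrite -subr_eq0 -(cinnerBl Lg Lh Lw).
apply/eqP/cmod_eq0/eqP; rewrite eq_le cmod_ge0 andbT.
by apply: le_trans (cauchy_schwarz (L2B Lg Lh) Lw) _; rewrite gh mul0r.
Qed.

Let LsF : L2 mu (fun x => \sum_o F o x).
Proof. exact: L2_sum. Qed.

Lemma cinner_component_sum w : L2 mu w ->
  cinner mu f w = \sum_o cinner mu (F o) w.
Proof.
by move=> Lw; rewrite (nrm0_cinner Lf LsF Lw fF) (cinner_suml _ _ Lw).
Qed.

Lemma cinner_component o w : component o w -> cinner mu f w = cinner mu (F o) w.
Proof.
move=> ow; rewrite (cinner_component_sum (component_L2 ow)) (bigD1 o)//= big1 ?addr0//.
by move=> o' o'o; exact: (component_orth o'o (cF o') ow).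
Qed.

Lemma parseval_component : nrm mu f ^+ 2 = \sum_o nrm mu (F o) ^+ 2.
Proof.
apply: complexI; rewrite -cinner_nrm (cinner_component_sum Lf) rmorph_sum.
apply: eq_bigr => o _; rewrite (cinnerC Lf (LF o)) (cinner_component (cF o)).
by rewrite cinner_nrm [LHS]conjc_real.
Qed.

Lemma component_of_nrm0 o : (forall o', o' != o -> nrm mu (F o') = 0) -> component o f.
Proof.
move=> F0; apply: (closed_nrm0 (component_closed o) (cF o) Lf).
apply/eqP; rewrite nrmBC eq_le nrm_ge0 andbT.
apply: le_trans (nrmB_trans Lf LsF (LF o)) _; rewrite fF add0r.
have -> : (fun x => \sum_o F o x - F o x) = fun x => \sum_(o' | o' != o) F o' x.
  by apply/funext => x; rewrite (bigD1 o)//= addrC addrK.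
rewrite -(@ler_pXn2r _ 2) ?nnegrE ?nrm_ge0// expr0n -lecR -cinner_nrm.
have Ls : L2 mu (fun x => \sum_(o' | o' != o) F o' x) by exact: L2_sum.
rewrite (cinner_suml _ _ Ls)// big1// => o' o'o; apply/cmod_eq0/eqP.
rewrite eq_le cmod_ge0 andbT.
by apply: le_trans (cauchy_schwarz (LF o') Ls) _; rewrite F0// mul0r.
Qed.

End GradedComponents.

(** * Diagonalisation of the triple product *)

Section TripleProduct.
Context {R : realType} {G : topologicalGroupType} (mu : probability (borel G) R).
Local Open Scope complex_scope.
Hypothesis cG : compact [set: G].
Hypothesis hG : hausdorff_space G.
Hypothesis hmu : haar mu.
Variables (n : nat) (V : grading mu n).

(** Each component [F o'] of [h] with [o' != o] is itself orthogonal to the component [o], hence an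
    allowed test function; testing [h] against it gives the squared norm of [F o'], which must
    vanish. *)
Lemma component_biperp o : biperp mu (component V o).
Proof.
move=> h Lh hperp; have [F [cF hF]] := component_sum V Lh.
apply: (component_of_nrm0 Lh cF hF) => o' o'o.
have LFo := component_L2 (cF o').
apply/eqP; rewrite -sqrf_eq0; apply/eqP/complexI; rewrite -cinner_nrm.
rewrite -(cinner_component Lh cF hF (cF o')); apply: hperp => // v ov.
by rewrite eq_sym in o'o; exact: (component_orth o'o ov (cF o')).
Qed.

Variable (f : borel G -> R[i]).
Hypothesis Lf : L2 mu f.
Variable F : option 'I_(uphalf n) -> borel G -> R[i].
Hypothesis cF : forall o, component V o (F o).
Hypothesis fF : nrm mu (fun x => f x - \sum_o F o x) = 0.

Let LF o : L2 mu (F o). Proof. exact: component_L2 (cF o). Qed.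

(* Left translations preserve every component, so only the diagonal terms of
   [<L_x f, f>] survive; integrating against [f], right translations kill the
   terms with [F o] and [F o'] for [o != o']. *)
Lemma triple_product_component :
  cinner mu (conv mu f f) f = \sum_o cinner mu (conv mu (F o) (F o)) (F o).
Proof.
have -> : conv mu f f = fun x => \sum_o conv mu (F o) (F o) x.
  apply/funext => x; rewrite convE.
  have Lx g : L2 mu g -> L2 mu (fun y => g (x * y)%g) by exact: L2_lmul.
  have LsF : L2 mu (fun x => \sum_o F o x) by exact: L2_sum.
  have LxF o : L2 mu (fun y => F o (x * y)%g) by exact: Lx.
  have Ls : L2 mu (fun y => \sum_o F o (x * y)%g) by exact: (Lx _ LsF).
  have fx : nrm mu (fun y => f (x * y)%g - \sum_o F o (x * y)%g) = 0.
    by rewrite (nrm_lmul hmu x (L2B Lf LsF)).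
  rewrite (nrm0_cinner (Lx _ Lf) Ls Lf fx) (cinner_suml _ _ Lf)//.
  apply: eq_bigr => o _; rewrite convE (cinnerC Lf (LxF o)).
  have cx : component V o (fun y => F o (x * y)%g) by apply: component_left.
  by rewrite (cinner_component Lf cF fF cx) -(cinnerC (LF o) (LxF o)).
have Lc o : L2 mu (conv mu (F o) (F o)) by exact: conv_L2.
rewrite (cinner_suml _ _ Lf)//; apply: eq_bigr => o _.
have cc : component V o (conv mu (F o) (F o)).
  apply: component_biperp => // w Lw hw.
  exact: (conv_orth cG hG hmu (component_right (V := V) (o := o)) (LF o) (LF o) Lw (cF o) hw).
by rewrite (cinnerC Lf (Lc o)) (cinner_component Lf cF fF cc) -(cinnerC (LF o) (Lc o)).
Qed.

End TripleProduct.

(** * Pairing with an indicator function *)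

Section IndicatorHoelder.
Context {d} {T : measurableType d} {R : realType} (mu : probability T R).
Local Notation Re := complex.Re.
Local Open Scope complex_scope.
Variable A : set T.
Hypothesis mA : measurable A.
Let f : T -> R[i] := fun x => (\1_A x)%:C.
Let alpha : R := fine (mu A).

Lemma Rintegral_indic : \int[mu]_x (\1_A x : R) = alpha.
Proof. by rewrite /Rintegral integral_indic// setIT. Qed.

Lemma nrm_indic_sqr : nrm mu f ^+ 2 = alpha.
Proof.
rewrite nrm_sqr -Rintegral_indic; apply: eq_Rintegral => x _.
rewrite cmodr real_normK ?num_real// indicE.
by case: (x \in A); rewrite ?expr1n ?expr0n.
Qed.

Lemma cinner_indic1 : cinner mu f (fun=> 1) = alpha%:C.
Proof.
rewrite -nrm_indic_sqr -cinner_nrm.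
apply/eqP; rewrite -subr_eq0; apply/eqP.
have Lf : L2 mu f by exact: L2_indic.
rewrite -(cinnerBr (L2_cst mu 1) Lf Lf); apply: cinner_eq0 => x.
rewrite /f indicE; case: (x \in A); last by rewrite mul0r.
by rewrite rmorphB !rmorph1 subrr mulr0.
Qed.

(** Hoelder with exponents [q] and [(1 - q^-1)^-1]. The bound lives in the extended reals since [h]
    is not assumed to have a finite [q]-norm; hypercontractivity supplies that later. *)
Lemma Re_cinner_indic_le h (q : R) : 1 < q -> L2 mu h ->
  ((Re (cinner mu h f))%:E <= cLnorm mu q%:E h * (alpha `^ (1 - q^-1))%:E)%E.
Proof.
move=> q1 Lh; have Lf : L2 mu f by exact: L2_indic.
have q0 : 0 < q := lt_trans ltr01 q1.
have p0 : 0 < (1 - q^-1)^-1 by rewrite invr_gt0 subr_gt0 invf_lt1.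
have pq : q^-1 + (1 - q^-1)^-1^-1 = 1 by rewrite invrK addrC subrK.
have mh := cmeas_cmod (L2_cmeas Lh).
have mI : measurable_fun setT (\1_A : T -> R) by exact/measurable_indicP.
have := hoelder mu mh mI q0 p0 pq.
rewrite Lnorm1 => hol.
have -> : (alpha `^ (1 - q^-1))%:E = Lnorm mu ((1 - q^-1)^-1)%:E (EFin \o \1_A).
  rewrite unlock invrK.
  have -> : (\int[mu]_x (`|(EFin \o \1_A) x| `^ (1 - q^-1)^-1) = mu A)%E.
    transitivity (\int[mu]_x (\1_A x)%:E)%E; last by rewrite integral_indic// setIT.
    apply: eq_integral => x _ /=.
    rewrite indicE; case: (x \in A); rewrite ?normr1 ?powR1 ?normr0//.
    by rewrite powR0// gt_eqF.
  by rewrite -poweR_EFin fineK// fin_num_measure.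
apply: le_trans hol.
rewrite Re_cinner; have [i1 _] := L2_cintegrable Lh Lf.
rewrite /Rintegral fineK; last exact: integrable_fin_num.
apply: le_trans (lee_abs _) _; apply: le_trans (le_abse_integral _ _ _) _ => //.
  exact: measurable_int i1.
apply: ge0_le_integral => //.
- by apply: measurableT_comp => //; exact: measurable_int i1.
- by apply: measurableT_comp => //; apply/measurable_EFinP; exact: measurable_funM.
- move=> x _; rewrite lee_fin /=.
  apply: le_trans (cmod_Re _) _; rewrite cmodM cmodJ cmodr.
  by rewrite normrM (ger0_norm (cmod_ge0 _)).
Qed.

End IndicatorHoelder.

(** * The level inequality from hypercontractivity *)

Section LevelInequality.
Context {R : realType} {G : topologicalGroupType} (mu : probability (borel G) R).
Local Open Scope complex_scope.
Variables (n : nat) (V : grading mu n).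

(** [g'] witnesses that the choice made by [proj] succeeds. The difference of the two candidates
    lies in [W], while both residuals are orthogonal to [W], so it is orthogonal to itself. *)
Lemma projP (W : set (borel G -> R[i])) g g' : closed_subspace mu W -> L2 mu g ->
  W g' -> (forall h, W h -> cinner mu (fun x => g x - g' x) h = 0) ->
  L2 mu (Defs.proj mu W g) /\ nrm mu (fun x => Defs.proj mu W g x - g' x) = 0.
Proof.
move=> cW Lg Wg' hg'.
have [Wp hp] : W (Defs.proj mu W g) /\
    forall h, W h -> cinner mu (fun x => g x - Defs.proj mu W g x) h = 0.
  apply: (@xgetPex _ (fun=> 0) [set g0 | W g0 /\
    forall h, W h -> cinner mu (fun x => g x - g0 x) h = 0]).
  by exists g'.
have Lp := closed_L2 cW Wp; have Lg' := closed_L2 cW Wg'.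
split => //; set D := (fun x => _).
have WD : W D := linear_setB (closed_linear cW) Wp Wg'.
have LD := closed_L2 cW WD.
apply/eqP; rewrite -sqrf_eq0; apply/eqP/complexI; rewrite -cinner_nrm.
have alg (a b c : R[i]) : a - b = (c - b) - (c - a) by ring.
have eD : D = fun x => (g x - g' x) - (g x - Defs.proj mu W g x).
  by apply/funext => x; exact: alg.
rewrite {1}eD (cinnerBl (L2B Lg Lg') (L2B Lg Lp) LD) hp// hg'// subrr.
by [].
Qed.

(** On a single level the noise operator is multiplication by [delta ^+ e], but only a.e., because
    [proj] is determined up to a null set; hence the form with inner products. *)
Lemma cinner_noise (delta r : R) (e : 'I_(uphalf n)) g w : level V e g -> L2 mu w ->
  e%:R <= r -> L2 mu (noise V delta r g) /\
  cinner mu (noise V delta r g) w = (delta ^+ e)%:C * cinner mu g w.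
Proof.
move=> Vg Lw er; have Lg := closed_L2 (level_closed V e) Vg.
have pe : L2 mu (Defs.proj mu (level V e) g) /\
    nrm mu (fun x => Defs.proj mu (level V e) g x - g x) = 0.
  apply: projP => //; first exact: level_closed.
  move=> h Vh; apply: cinner_eq0 => x.
  by rewrite subrr mul0r.
have pi i : i != e -> L2 mu (Defs.proj mu (level V i) g) /\
    nrm mu (fun x => Defs.proj mu (level V i) g x - 0) = 0.
  move=> ie; have [_ V0 _ _] := level_closed V i.
  apply: (projP (g' := fun=> 0)) => //; first exact: level_closed.
  move=> h Vh; have -> : (fun x => g x - 0) = g by apply/funext => x; rewrite subr0.
  by apply: (level_orth (g := V) (d := e) (e := i)) => //; rewrite eq_sym.
have Lp i : L2 mu (Defs.proj mu (level V i) g).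
  by have [->|/pi[]] := eqVneq i e; [exact: pe.1|].
have LZ (i : 'I_(uphalf n)) : L2 mu (fun x => (delta ^+ i)%:C * Defs.proj mu (level V i) g x) by exact: L2Z.
split; first exact: L2_sum.
rewrite /noise (cinner_suml _ (fun i _ => LZ i) Lw) (bigD1 e)//=.
rewrite (cinnerZl _ (Lp e) Lw) (nrm0_cinner (Lp e) Lg Lw pe.2).
rewrite big1 ?addr0// => i /andP[_ ie].
rewrite (cinnerZl _ (Lp i) Lw) (nrm0_cinner (Lp i) (L2_cst mu 0) Lw (pi i ie).2).
by rewrite cinner0l mulr0.
Qed.

(** Pair the noise of [F], not of the indicator, with the indicator: this is [delta^e |F|^2], and by
    Hoelder and hypercontractivity it is at most [|F|] times the power of the measure. Dividing by
    [|F|] leaves the claim. *)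
Lemma level_inequality (A : set (borel G)) (r K q : R) (e : 'I_(uphalf n))
    (F : borel G -> R[i]) :
  measurable A -> 0 < K -> hypercontractive V r K -> 2 <= q -> e%:R <= r ->
  level V e F ->
  cinner mu (fun x => (\1_A x)%:C) F = (nrm mu F ^+ 2)%:C ->
  nrm mu F <= fine (mu A) `^ (1 - q^-1) * (Num.max K 1 * Num.sqrt q) ^+ e.
Proof.
move=> mA K0 hyp q2 er VF fF.
have LF := closed_L2 (level_closed V e) VF.
have Lf : L2 mu (fun x : borel G => (\1_A x)%:C) by exact: L2_indic.
have q1 : 1 < q by lra.
have sq : 0 < Num.sqrt q by rewrite sqrtr_gt0; lra.
have sq1 : 1 <= Num.sqrt q by rewrite -[leLHS]sqrtr1 ler_wsqrtr//; lra.
(* The maximum with 1 ensures [delta <= 1], which hypercontractivity demands besides the bound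
   involving [K]. *)
pose L := Num.max K 1; have L1 : 1 <= L by rewrite le_max lexx orbT.
have LK : K <= L by rewrite le_max lexx.
have L0 : 0 < L by lra.
pose delta := (L * Num.sqrt q)^-1.
have d0 : 0 < delta by rewrite invr_gt0 mulr_gt0.
have d1 : delta <= 1 by rewrite invf_le1 ?mulr_gt0// mulr_ege1.
have dK : delta <= 1 / (K * Num.sqrt q).
  by rewrite div1r lef_pV2 ?posrE ?mulr_gt0// ler_pM2r.
have [LN Nf] := cinner_noise delta VF Lf er.
have h01 : 0 <= delta <= 1 by rewrite (ltW d0).
have := hyp q delta q2 h01 dK F LF; rewrite (cLnorm_nrm LF) => hN.
have := Re_cinner_indic_le mA q1 LN; rewrite Nf.
have -> : cinner mu F (fun x : borel G => (\1_A x)%:C) = (nrm mu F ^+ 2)%:C.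
  by rewrite (cinnerC Lf LF) fF [LHS]conjc_real.
rewrite -rmorphM => hle.
have : ((delta ^+ e * nrm mu F ^+ 2)%:E <=
    (nrm mu F * fine (mu A) `^ (1 - q^-1))%:E)%E.
  apply: le_trans hle _; rewrite EFinM; apply: lee_wpmul2r => //.
  by rewrite lee_fin powR_ge0.
rewrite lee_fin => {}hle.
have [F0|F0] := eqVneq (nrm mu F) 0.
  by rewrite F0 mulr_ge0 ?powR_ge0// exprn_ge0// mulr_ge0// ltW.
have Fgt : 0 < nrm mu F by rewrite lt_def F0 nrm_ge0.
have dE : (L * Num.sqrt q) ^+ e = (delta ^+ e)^-1 by rewrite /delta exprVn invrK.
rewrite -/L dE ler_pdivlMr ?exprn_gt0//.
rewrite -(ler_pM2r Fgt); apply: le_trans (le_trans _ hle) _; last by rewrite mulrC.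
by rewrite expr2 mulrA [_ * delta ^+ _]mulrC.
Qed.

End LevelInequality.

(** * Choice of the constants *)

Section Constants.
Context {R : realType}.
Implicit Types c C K L s : R.

(** Used with [n = s^3], so that conditions on fractional powers of [n] become polynomial in [s]. *)
Lemma powR_half_third (s : R) : 0 <= s ->
  (s ^+ 3) `^ (1 / 3) = s /\ (1 <= s -> s <= (s ^+ 3) `^ (1 / 2)).
Proof.
move=> s0.
have E : (s ^+ 3) `^ (1 / 3) = s.
  by rewrite -powR_mulrn// -powRrM mul1r mulfV// powRr1.
split => // s1; rewrite -[X in X <= _]E; apply: ler_powR; last by lra.
by rewrite exprn_ege1.
Qed.

Lemma ln1Dx_gt0 c : 0 < c -> 0 < ln (1 + c).
Proof. by move=> c0; rewrite ln_gt0// ltrDl. Qed.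

Lemma Qtop_ge c (n : nat) L : 0 < c -> 4 * L <= c * n%:R / (1 + c) * ln (1 + c) ->
  expR (4 * L) <= Qtop c n.
Proof.
move=> c0 hL; rewrite /Qtop; have c1 : 0 < 1 + c by lra.
have -> : (1 + c) `^ (c * n%:R / (1 + c)) = expR (c * n%:R / (1 + c) * ln (1 + c)).
  by rewrite /powR gt_eqF.
by rewrite ler_expR.
Qed.

(* [d ln (c n / d) >= 4 L] as soon as [L / 2 < d < c n / (1 + c)]: if [d] is
   large the logarithm is at least [ln (1 + c)], otherwise it is at least [8]. *)
Lemma Qlevel_ge c (n d : nat) L : 0 < c -> 0 < L ->
  4 * L <= c * n%:R / (1 + c) * ln (1 + c) ->
  expR 8 * (4 * L) <= c * n%:R * ln (1 + c) ->
  L / 2 < d%:R -> expR (4 * L) <= Qlevel c n d.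
Proof.
move=> c0 L0 h1 h2 Ld; rewrite /Qlevel; case: ifPn => [dc|_]; last exact: Qtop_ge.
have d0 : 0 < d%:R :> R by lra.
have l0 := ln1Dx_gt0 c0; have c1 : 0 < 1 + c by lra.
have cn : 1 + c < c * n%:R / d%:R.
  by rewrite ltr_pdivlMr// mulrC -ltr_pdivlMr.
have cnp : 0 < c * n%:R / d%:R by lra.
have -> : (c * n%:R / d%:R) ^+ d = expR (d%:R * ln (c * n%:R / d%:R)).
  by rewrite expRM_natl lnK.
rewrite ler_expR.
have [dl|dl] := leP (4 * L / ln (1 + c)) d%:R.
  rewrite ler_pdivrMr// in dl; apply: le_trans dl _.
  by rewrite ler_pM2l// ler_ln ?posrE// ltW.
have : 8 <= ln (c * n%:R / d%:R).
  rewrite -[leLHS](expRK 8) ler_ln ?posrE ?expR_gt0// ler_pdivlMr//.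
  rewrite ltr_pdivlMr// in dl.
  rewrite -(ler_pM2r l0); apply: le_trans _ h2; rewrite -mulrA ler_pM2l ?expR_gt0//.
  exact: ltW.
by rewrite -(ler_pM2l d0); lra.
Qed.

(** For [d <= L / 2] the first bound puts [d] below the hypercontractivity cutoff, the second
    selects the polynomial branch of [Qlevel], and the third is what gains [4^-d] in
    [low_level_term_le]. *)
Lemma constants_exist c C : 0 < c -> 0 < C -> exists (c' : R) (n0 : nat),
  [/\ 0 < c', (0 < n0)%N & forall n : nat, (n0 < n)%N ->
   let L := c' * n%:R `^ (1 / 3) in
   [/\ 2 <= L,
     forall d : nat, (0 < d)%N -> d%:R <= L / 2 ->
       [/\ d%:R <= c * n%:R `^ (1 / 2), Qlevel c n d = (c * n%:R / d%:R) ^+ d &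
         16 * ((expR 1 * Num.max C 1) ^+ 2 * (L / d%:R)) ^+ 3 <= c * n%:R / d%:R],
     forall d : nat, L / 2 < d%:R -> expR (4 * L) <= Qlevel c n d &
     expR (4 * L) <= Qtop c n]].
Proof.
move=> c0 C0; pose B := expR 1 * Num.max C 1.
have B1 : 1 <= B.
  rewrite mulr_ege1 ?le_max ?lexx ?orbT//.
  by have := expR_ge1Dx (1 : R); lra.
have B6 : 1 <= B ^+ 6 by rewrite exprn_ege1.
have c1 : 0 < 1 + c by lra.
have B16 : 1 <= 16 * B ^+ 6 by lra.
(* Dropping factors that are at least 1 from the equation [hc] below yields both [c' (1 + c) <= c]
   and [16 B^6 c' <= c]. *)
have den0 : 0 < (1 + c) * (16 * B ^+ 6) by rewrite mulr_gt0//; lra.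
have [c' c'0 hc] : exists2 c', 0 < c' & c' * ((1 + c) * (16 * B ^+ 6)) = c.
  by exists (c / ((1 + c) * (16 * B ^+ 6))); rewrite ?divr_gt0// divfK// gt_eqF.
have c'1 : c' * (1 + c) <= c.
  by rewrite -[leRHS]hc ler_pM2l// ler_peMr// ltW.
have c'c : c' <= c by nra.
have c'le1 : c' <= 1 by nra.
have c'B : 16 * B ^+ 6 * c' <= c.
  have : 16 * B ^+ 6 * c' <= (1 + c) * (16 * B ^+ 6 * c').
    have X0 : 0 < 16 * B ^+ 6 * c' by rewrite mulr_gt0//; lra.
    by rewrite ler_peMl ?(ltW X0)//; lra.
  by rewrite (_ : (1 + c) * (16 * B ^+ 6 * c') = c)// -[RHS]hc; ring.
have l0 := ln1Dx_gt0 c0.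
pose b := c / (1 + c) * ln (1 + c); have b0 : 0 < b by rewrite mulr_gt0// divr_gt0.
pose b2 := c * ln (1 + c); have b20 : 0 < b2 by rewrite mulr_gt0.
have e8 : 0 < expR 8 :> R := expR_gt0 _.
(* One summand per requirement on [s = n^(1/3)]: [1 <= s], [4 <= s * b], [4 * expR 8 <= s * b2] and
   [2 <= s * c']. *)
pose S0 : R := 1 + 4 / b + 4 * expR 8 / b2 + 2 / c'.
have t1 : 0 < 4 / b by rewrite divr_gt0.
have t2 : 0 < 4 * expR 8 / b2 by rewrite divr_gt0// mulr_gt0.
have t3 : 0 < 2 / c' by rewrite divr_gt0.
exists c', (Num.bound (S0 ^+ 3)).+1; split => // n nn0 L.
pose s : R := n%:R `^ (1 / 3).
have s0 : 0 <= s by rewrite powR_ge0.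
have nE : n%:R = s ^+ 3.
  by rewrite -powR_mulrn// -powRrM -mulrA mulVf// mulr1 powRr1.
have sS : S0 <= s.
  rewrite -(@ler_pXn2r _ 3) ?nnegrE//; last by rewrite /S0; lra.
  rewrite -nE; apply: le_trans (ltW (archi_boundP _)) _.
    by rewrite exprn_ge0// /S0; lra.
  by rewrite ler_nat; exact: ltnW (ltnW nn0).
have s1 : 1 <= s by move: sS; rewrite /S0; lra.
have sb : 4 <= s * b by rewrite -ler_pdivrMr//; move: sS; rewrite /S0; lra.
have sb2 : 4 * expR 8 <= s * b2 by rewrite -ler_pdivrMr//; move: sS; rewrite /S0; lra.
have sc : 2 <= s * c' by rewrite -ler_pdivrMr//; move: sS; rewrite /S0; lra.
have [_ /(_ s1) shalf] := powR_half_third s0.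
have L2 : 2 <= L by rewrite /L -/s mulrC.
have L0 : 0 < L by lra.
have Ls : L <= s by rewrite /L -/s -[leRHS]mul1r ler_pM2r//; lra.
have h1 : 4 * L <= c * n%:R / (1 + c) * ln (1 + c).
  have -> : c * n%:R / (1 + c) * ln (1 + c) = s * b * s ^+ 2.
    by rewrite nE /b; field; rewrite gt_eqF.
  have : s <= s ^+ 2 by rewrite expr2 ler_peMr.
  nra.
have h2 : expR 8 * (4 * L) <= c * n%:R * ln (1 + c).
  have -> : c * n%:R * ln (1 + c) = s * b2 * s ^+ 2 by rewrite nE /b2; ring.
  have : s <= s ^+ 2 by rewrite expr2 ler_peMr.
  move=> ss; apply: (@le_trans _ _ (4 * expR 8 * s)).
    by rewrite mulrCA mulrA ler_pM2l// mulr_gt0.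
  by apply: ler_pM => //; rewrite mulr_ge0// ltW.
split => //; last 2 first.
- by move=> d; exact: Qlevel_ge.
- exact: Qtop_ge.
move=> d d0 dL; have dR : 1 <= d%:R :> R by rewrite ler1n.
have LE : L = c' * s by [].
have s3 : s <= s ^+ 3 by rewrite exprS ler_peMr// exprn_ege1.
split.
- rewrite nE; apply: (@le_trans _ _ (c * s)); last by rewrite ler_pM2l.
  by rewrite (le_trans dL)// LE; nra.
- rewrite /Qlevel ifT// ltr_pdivlMr// nE.
  have : L / 2 * (1 + c) < c * s ^+ 3.
    have : L * (1 + c) <= c * s by rewrite LE mulrAC ler_wpM2r.
    have : c * s <= c * s ^+ 3 by rewrite ler_pM2l.
    have : 0 < L * (1 + c) by rewrite mulr_gt0.
    lra.
  by apply: le_lt_trans; rewrite ler_pM2r.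
have dp : 0 < d%:R :> R by lra.
rewrite -/B -(ler_pM2r (exprn_gt0 3 dp)).
have -> : 16 * (B ^+ 2 * (L / d%:R)) ^+ 3 * d%:R ^+ 3 = 16 * B ^+ 6 * c' * (c' ^+ 2 * s ^+ 3).
  by rewrite LE; field; rewrite gt_eqF.
have -> : c * n%:R / d%:R * d%:R ^+ 3 = c * (d%:R ^+ 2 * s ^+ 3).
  by rewrite nE; field; rewrite gt_eqF.
apply: ler_pM => //.
- by rewrite mulr_ge0 ?ltW// mulr_gt0//; lra.
- by rewrite mulr_ge0 ?exprn_ge0// ltW.
rewrite ler_wpM2r ?exprn_ge0// (@le_trans _ _ 1)//.
  by rewrite exprn_ile1// ltW.
by rewrite exprn_ege1.
Qed.

End Constants.

(** * Product-free sets *)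

Section ProductFree.
Context {R : realType} {G : topologicalGroupType} (mu : probability (borel G) R).
Local Open Scope complex_scope.
Local Notation "z ^*" := (Num.conj z) : complex_scope.
Hypothesis cG : compact [set: G].
Hypothesis hG : hausdorff_space G.
Hypothesis hmu : haar mu.
Variable A : set (borel G).
Hypothesis mA : measurable A.
Let f : borel G -> R[i] := fun x => (\1_A x)%:C.
Let alpha : R := fine (mu A).
Let Lf : L2 mu f. Proof. exact: L2_indic. Qed.

Lemma product_free_conv : product_free (A : set G) ->
  cinner mu (conv mu f f) f = 0.
Proof.
move=> pf; apply: cinner_eq0 => x.
have f0 y : ~ A y -> f y = 0 by move=> Ay; rewrite /f indicE memNset.
have [Ax|Ax] := pselect (A x); last by rewrite f0// rmorph0 mulr0.
rewrite convE cinner_eq0 ?mul0r// => y.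
have [Ay|Ay] := pselect (A y); last by rewrite [f y]f0// rmorph0 mulr0.
by rewrite f0 ?mul0r//; exact: pf.
Qed.

Variables (n : nat) (V : grading mu n).
Variable F : option 'I_(uphalf n) -> borel G -> R[i].
Hypothesis cF : forall o, component V o (F o).
Hypothesis fF : nrm mu (fun x => f x - \sum_o F o x) = 0.
Let LF o : L2 mu (F o). Proof. exact: component_L2 (cF o). Qed.

(** Level 0 consists of the a.e. constant functions; pairing with 1 identifies the constant as
    [alpha]. *)
Lemma triple_product_level0 (d : 'I_(uphalf n)) : d = 0%N :> nat ->
  cinner mu (conv mu (F (Some d)) (F (Some d))) (F (Some d)) = (alpha ^+ 3)%:C.
Proof.
move=> d0; set g := F (Some d).
have Lg : L2 mu g by exact: LF.
have L1 : L2 mu (fun=> 1 : R[i]) by exact: L2_cst.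
have : component V (Some d) g by exact: cF.
rewrite /= (level0 V d0) => -[_ [a ga]].
have La : L2 mu (fun=> a) by exact: L2_cst.
have ga0 : nrm mu (fun x => g x - a) = 0.
  apply/nrm_eq0P; first exact: L2B.
  by apply: filterS ga => x ->; rewrite subrr.
have c11 : cinner mu (fun=> 1 : R[i]) (fun=> 1) = 1.
  by rewrite cinner_nrm nrm_cst cmod1 expr1n.
have ca1 b : cinner mu (fun=> b : R[i]) (fun=> 1) = b.
  have -> : (fun=> b) = (fun x : borel G => b * 1 : R[i]).
    by apply/funext => x; rewrite mulr1.
  by rewrite (cinnerZl _ L1 L1) c11 mulr1.
have c1 : component V (Some d) (fun=> 1).
  rewrite /= (level0 V d0); split => //; exists 1; exact: nearW.
have g1 : cinner mu g (fun=> 1) = alpha%:C.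
  by rewrite -(cinner_component Lf cF fF c1) cinner_indic1.
have ea : a = alpha%:C.
  by rewrite -g1 (nrm0_cinner Lg La L1 ga0) ca1.
have -> : conv mu g g = fun=> (alpha ^+ 2)%:C.
  apply/funext => x; rewrite convE.
  have Lxg : L2 mu (fun y => g (x * y)%g) by exact: L2_lmul.
  have xga : nrm mu (fun y => g (x * y)%g - a) = 0.
    by rewrite (nrm_lmul hmu x (L2B Lg La)).
  rewrite (nrm0_cinner Lxg La Lg xga) (cinnerC Lg La).
  rewrite (nrm0_cinner Lg La La ga0) cinner_nrm nrm_cst ea cmodr.
  by rewrite [LHS]conjc_real real_normK ?num_real.
have -> : (fun=> (alpha ^+ 2)%:C) = (fun x : borel G => (alpha ^+ 2)%:C * 1 : R[i]).
  by apply/funext => x; rewrite mulr1.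
rewrite (cinnerZl _ L1 Lg) (cinnerC Lg L1) g1.
have -> : (alpha%:C)^* = alpha%:C :> R[i] by exact: conjc_real.
by rewrite -rmorphM -exprSr.
Qed.

Definition Qcomp (c : R) (o : option 'I_(uphalf n)) : R :=
  if o is Some d then Qlevel c n d else Qtop c n.

Definition nontrivial (o : option 'I_(uphalf n)) : bool :=
  if o is Some d then (0 < d)%N else true.

Lemma triple_product_le (c : R) (o : option 'I_(uphalf n)) :
  strongly_quasirandom V c -> 0 < Qcomp c o ->
  nontrivial o ->
  cmod (cinner mu (conv mu (F o) (F o)) (F o)) * Num.sqrt (Qcomp c o) <=
  nrm mu (F o) ^+ 3.
Proof.
move=> [Ql Qh] Q0 od.
have dQ : subreps_dim_ge mu (component V o) (Qcomp c o).
  by case: o od {Q0} => [d|] // d0; exact: Ql.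
have := quasirandom_conv_le cG hG hmu (component_closed V o) (component_left (V := V) (o := o))
  (component_right (V := V) (o := o)) (component_biperp (V := V) (o := o)) (ltW Q0) dQ (cF o).
have Lc : L2 mu (conv mu (F o) (F o)) by exact: conv_L2.
set x := nrm mu (conv mu (F o) (F o)); set y := nrm mu (F o) => hx.
have x0 : 0 <= x by exact: nrm_ge0.
have y0 : 0 <= y by exact: nrm_ge0.
have sQ : 0 <= Num.sqrt (Qcomp c o) by rewrite sqrtr_ge0.
have hx2 : x * Num.sqrt (Qcomp c o) <= y ^+ 2.
  rewrite -(@ler_pXn2r _ 2) ?nnegrE ?mulr_ge0 ?sqr_ge0//.
  by rewrite exprMn (sqr_sqrtr (ltW Q0)) -exprM.
apply: le_trans (ler_wpM2r sQ (cauchy_schwarz Lc (LF o))) _.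
by rewrite -/x -/y mulrAC exprSr ler_wpM2r.
Qed.

Lemma cube_measure_le (c : R) : strongly_quasirandom V c -> (0 < n)%N ->
  (forall o, 0 < Qcomp c o) -> product_free (A : set G) ->
  alpha ^+ 3 <= \sum_(o | nontrivial o)
    nrm mu (F o) ^+ 3 / Num.sqrt (Qcomp c o).
Proof.
move=> qr n0 Q0 pf.
have u0 : (0 < uphalf n)%N by rewrite uphalf_gt0.
pose d0 : 'I_(uphalf n) := Ordinal u0.
have := triple_product_component cG hG hmu Lf cF fF.
rewrite product_free_conv// (bigD1 (Some d0))//= (triple_product_level0 (d := d0))//.
move/eqP; rewrite eq_sym addr_eq0 => /eqP /(congr1 cmod); rewrite cmodN cmodr ger0_norm; last first.
  by rewrite exprn_ge0// fine_ge0.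
move=> ->.
have E : (fun o => o != Some d0) =1 nontrivial.
  move=> [d|] //; rewrite /nontrivial lt0n; apply/idP/idP; apply: contra => /eqP.
    by move=> h; apply/eqP; congr Some; apply: val_inj.
  by move=> [] ->.
rewrite (eq_bigl _ _ E).
apply: (@le_trans _ _ (\sum_(o | nontrivial o)
    cmod (cinner mu (conv mu (F o) (F o)) (F o)))).
  elim/big_ind2: _ => //; first by rewrite cmod0.
  by move=> x1 x2 y1 y2 h1 h2; apply: le_trans (cmodD _ _) (lerD h1 h2).
apply: ler_sum => o od; rewrite ler_pdivlMr ?sqrtr_gt0//.
exact: triple_product_le.
Qed.

End ProductFree.

Lemma sum_geometric_le {R : realType} (m : nat) :
  \sum_(d < m | (0 < d)%N) (4^-1 : R) ^+ d <= 1 / 3.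
Proof.
suff : \sum_(d < m.+1 | (0 < d)%N) (4^-1 : R) ^+ d = (1 - 4^-1 ^+ m) / 3.
  move=> h; apply: (@le_trans _ _ (\sum_(d < m.+1 | (0 < d)%N) (4^-1 : R) ^+ d)).
    rewrite [leRHS]big_mkcond big_ord_recr /= -big_mkcond lerDl.
    by case: ifP => // _; rewrite exprn_ge0.
  rewrite h ler_pM2r// lerBlDr lerDl exprn_ge0//.
elim: m => [|m IH].
  by rewrite big_mkcond big_ord_recr big_ord0 /= add0r expr0 subrr mul0r.
rewrite big_mkcond big_ord_recr -big_mkcond /= IH.
by rewrite exprS; field.
Qed.

(** * Numerical estimates for the low and the high levels *)

Section ProductFreeBound.
Context {R : realType}.
Local Open Scope complex_scope.

Lemma Qlevel_gt0 (c : R) (n d : nat) : 0 < c -> (0 < n)%N -> 0 < Qlevel c n d.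
Proof.
move=> c0 n0; rewrite /Qlevel; case: ifP => _; last first.
  by rewrite powR_gt0//; lra.
(* At [d = 0] the exponent is 0, so the value is 1 whatever the division by zero returns. *)
case: d => [|d]; first by rewrite expr0.
by rewrite exprn_gt0// divr_gt0// mulr_gt0// ltr0n.
Qed.

(** With [X = B sqrt(L/d)] the numerical hypothesis says [(4 X^3)^2 <= c n/d]. Hence the square root
    in the denominator is at least [(4 X^3)^d], which absorbs the [X^(3d)] coming from [N^3] and
    leaves [4^-d]. *)
Lemma low_level_term_le (c L B alpha N : R) (n d : nat) :
  0 < c -> (0 < n)%N -> (0 < d)%N -> 0 < L -> 0 < B -> 0 < alpha -> 0 <= N ->
  16 * (B ^+ 2 * (L / d%:R)) ^+ 3 <= c * n%:R / d%:R ->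
  N <= alpha * (B * Num.sqrt (L / d%:R)) ^+ d ->
  N ^+ 3 / Num.sqrt ((c * n%:R / d%:R) ^+ d) <= alpha ^+ 3 * 4^-1 ^+ d.
Proof.
move=> c0 n0 d0 L0 B0 a0 N0 hX hN.
have dR : 0 < d%:R :> R by rewrite ltr0n.
have q0 : 0 < L / d%:R by rewrite divr_gt0.
set X := B * Num.sqrt (L / d%:R) in hN.
have X0 : 0 < X by rewrite mulr_gt0// sqrtr_gt0.
have X2 : B ^+ 2 * (L / d%:R) = X ^+ 2.
  by rewrite /X exprMn (sqr_sqrtr (ltW q0)).
rewrite X2 in hX.
have y0 : 0 < c * n%:R / d%:R by rewrite divr_gt0// mulr_gt0// ltr0n.
have sq : (4 * X ^+ 3) ^+ d <= Num.sqrt ((c * n%:R / d%:R) ^+ d).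
  have p0 : 0 <= (4 * X ^+ 3) ^+ d by rewrite exprn_ge0// mulr_ge0// exprn_ge0// ltW.
  rewrite -(ger0_norm p0) -sqrtr_sqr ler_wsqrtr// -exprM mulnC exprM.
  rewrite lerXn2r ?nnegrE ?sqr_ge0 ?(ltW y0)//.
  by apply: le_trans hX; rewrite le_eqVlt; apply/orP; left; apply/eqP; ring.
have p0 : 0 < (4 * X ^+ 3) ^+ d by rewrite exprn_gt0// mulr_gt0// exprn_gt0.
rewrite ler_pdivrMr; last exact: lt_le_trans sq.
apply: (@le_trans _ _ (alpha ^+ 3 * 4^-1 ^+ d * (4 * X ^+ 3) ^+ d)); last first.
  by rewrite ler_wpM2l// mulr_ge0 ?exprn_ge0// ltW.
have -> : alpha ^+ 3 * 4^-1 ^+ d * (4 * X ^+ 3) ^+ d = (alpha * X ^+ d) ^+ 3.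
  rewrite -mulrA -exprMn mulrA mulVf// mul1r [RHS]exprMn; congr (_ * _).
  by rewrite -!exprM mulnC.
by rewrite lerXn2r// nnegrE// mulr_ge0 ?exprn_ge0// ltW.
Qed.

(** Only one factor [N] is traded for [sqrt(alpha)]; [N^2] is kept so that the levels can be summed
    by Parseval, whatever their number. *)
Lemma high_level_term_le (L Q alpha N : R) : 0 < alpha -> 0 <= N ->
  N ^+ 2 <= alpha -> expR (4 * L) <= Q ->
  N ^+ 3 / Num.sqrt Q <= Num.sqrt alpha * expR (- (2 * L)) * N ^+ 2.
Proof.
move=> a0 N0 hN hQ.
have sq : expR (2 * L) <= Num.sqrt Q.
  rewrite -(ger0_norm (expR_ge0 (2 * L))) -sqrtr_sqr ler_wsqrtr//.
  by rewrite -expRM_natl mulrA -natrM.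
rewrite ler_pdivrMr; last exact: lt_le_trans (expR_gt0 _) sq.
have Na : N <= Num.sqrt alpha by rewrite -(ger0_norm N0) -sqrtr_sqr ler_wsqrtr.
apply: (@le_trans _ _ (Num.sqrt alpha * expR (- (2 * L)) * N ^+ 2 * expR (2 * L))).
  have -> : Num.sqrt alpha * expR (- (2 * L)) * N ^+ 2 * expR (2 * L) =
      (expR (- (2 * L)) * expR (2 * L)) * (Num.sqrt alpha * N ^+ 2) by ring.
  by rewrite -expRD addNr expR0 mul1r exprS ler_wpM2r// sqr_ge0.
by rewrite ler_wpM2l// !mulr_ge0 ?sqrtr_ge0 ?expR_ge0// sqr_ge0.
Qed.

(** With [v = sqrt(alpha)] and [u = e^(-L/2)] the claim is [v^3 u^4 <= v^6 / 2]. It follows from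
    [u <= v], the lower bound on [alpha], and from [u <= 1/2], where [L >= 2] enters. *)
Lemma high_level_sum_le (L alpha : R) : 2 <= L -> expR (- L) < alpha ->
  Num.sqrt alpha * expR (- (2 * L)) * alpha <= alpha ^+ 3 / 2.
Proof.
move=> L2 La; have a0 : 0 < alpha := lt_trans (expR_gt0 _) La.
pose v := Num.sqrt alpha; pose u := expR (- (L / 2)).
have v0 : 0 < v by rewrite sqrtr_gt0.
have u0 : 0 < u := expR_gt0 _.
have va : alpha = v ^+ 2 by rewrite /v (sqr_sqrtr (ltW a0)).
have uE k : u ^+ k = expR (- (k%:R * (L / 2))).
  by rewrite /u -expRM_natl mulrN.
have u4 : expR (- (2 * L)) = u ^+ 4 by rewrite uE; congr expR; lra.
have u2 : u <= v.
  rewrite -(@ler_pXn2r _ 2) ?nnegrE ?(ltW u0) ?(ltW v0)// -va uE.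
  by rewrite (_ : - (2%:R * (L / 2)) = - L) ?(ltW La)//; lra.
have uh : u <= 1 / 2.
  have e1 : 1 + L / 2 <= expR (L / 2) := expR_ge1Dx _.
  rewrite /u expRN div1r lef_pV2 ?posrE ?expR_gt0//; lra.
rewrite u4 -/v va.
have -> : v * u ^+ 4 * v ^+ 2 = v ^+ 3 * (u ^+ 3 * u) by ring.
have -> : (v ^+ 2) ^+ 3 / 2 = v ^+ 3 * (v ^+ 3 * (1 / 2)) by field.
rewrite ler_pM2l ?exprn_gt0//; apply: ler_pM => //; rewrite ?exprn_ge0 ?(ltW u0)//.
by rewrite lerXn2r// nnegrE ltW.
Qed.

(** The lower bound on [alpha] limits the Hoelder loss [alpha^(-1/q)] to [e^(L/q)]. For [q = L/d]
    this is [e^d], the origin of the factor [expR 1] in [B]. *)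
Lemma powR_1B (alpha L q : R) : 0 < q -> expR (- L) < alpha ->
  alpha `^ (1 - q^-1) <= alpha * expR (L / q).
Proof.
move=> q0 La; have a0 : 0 < alpha := lt_trans (expR_gt0 _) La.
have -> : alpha `^ (1 - q^-1) = alpha * expR (- q^-1 * ln alpha).
  rewrite /powR gt_eqF// mulrDl mul1r expRD lnK//.
rewrite ler_pM2l// ler_expR.
have : - L <= ln alpha by rewrite -[leLHS](expRK (- L)) ler_ln ?posrE ?expR_gt0// ltW.
rewrite mulNr -mulrN mulrC => h; rewrite ler_pM2r ?invr_gt0//; lra.
Qed.

End ProductFreeBound.

Theorem theorem4p9 (R : realType) (c C : R) (c_gt0 : 0 < c) (C_gt0 : 0 < C) :
  exists (c' : R) (n0 : nat), 0 < c' /\ (0 < n0)%N /\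
    forall (n : nat) (G : topologicalGroupType)
      (mu : probability (borel G) R) (V : grading mu n),
      (n0 < n)%N ->
      compact [set: G] -> hausdorff_space G -> connected [set: G] ->
      haar mu ->
      hypercontractive V (c * n%:R `^ (1 / 2)) C ->
      strongly_quasirandom V c ->
      forall A : set (borel G), measurable A -> product_free (A : set G) ->
        (mu A <= (expR (- c' * n%:R `^ (1 / 3)))%:E)%E.

Proof.
have [c' [n0 [c'0 n00 hpar]]] := constants_exist c_gt0 C_gt0.
exists c', n0; do 2 split => //.
move=> n G mu V nn0 cG hG _ hmu hyp qr A mA pf.
have n_gt0 : (0 < n)%N by apply: leq_ltn_trans nn0.
have := hpar n nn0; set L := c' * _ => -[Lge2 low high top].
have L0 : 0 < L by lra.
have fA : mu A \is a fin_num by exact: fin_num_measure.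
rewrite -(fineK fA) lee_fin leNgt mulNr -/L; apply/negP.
set alpha := fine (mu A) => La.
have a0 : 0 < alpha := lt_trans (expR_gt0 _) La.
pose f : borel G -> R[i] := fun x => real_complex R (\1_A x).
have Lf : L2 mu f by exact: L2_indic.
have [F [cF fF]] := component_sum V Lf.
have Q0 (o : option 'I_(uphalf n)) : 0 < Qcomp c o.
  by case: o => [d|] /=; [exact: (Qlevel_gt0 _ c_gt0 n_gt0)|rewrite powR_gt0//; lra].
have := cube_measure_le cG hG hmu mA cF fF qr n_gt0 Q0 pf; rewrite -/alpha.
pose N o := nrm mu (F o).
have N0 o : 0 <= N o by exact: nrm_ge0.
have pars : \sum_o N o ^+ 2 = alpha.
  by rewrite -(parseval_component Lf cF fF) nrm_indic_sqr.
have Na o : N o ^+ 2 <= alpha.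
  by rewrite -pars (bigD1 o)//= lerDl sumr_ge0// => i _; exact: sqr_ge0.
pose B := expR 1 * Num.max C 1.
have C1 : 1 <= Num.max C 1 by rewrite le_max lexx orbT.
have B0 : 0 < B by rewrite mulr_gt0 ?expR_gt0//; lra.
(* [B1] accounts for the low levels and [E * N o ^+ 2] for the others. Both are nonnegative, so
   every component is bounded by their sum and no case split is needed when summing. *)
pose B1 (o : option 'I_(uphalf n)) : R :=
  if o is Some d then alpha ^+ 3 * 4^-1 ^+ d else 0.
pose E : R := Num.sqrt alpha * expR (- (2 * L)).
have E0 : 0 <= E by rewrite mulr_ge0 ?sqrtr_ge0 ?expR_ge0.
have B10 o : 0 <= B1 o.
  by case: o => //= d; rewrite mulr_ge0 ?exprn_ge0// ltW.
have term o : nontrivial o ->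
    N o ^+ 3 / Num.sqrt (Qcomp c o) <= B1 o + E * N o ^+ 2.
  case: o => [d|] /= od; last by rewrite add0r; exact: high_level_term_le.
  have dR : 0 < d%:R :> R by rewrite ltr0n.
  have [dL|dL] := leP (d%:R : R) (L / 2); last first.
    apply: le_trans (high_level_term_le a0 (N0 _) (Na _) (high d dL)) _.
    by rewrite lerDr; exact: (B10 (Some d)).
  have [dn QE hB] := low d od dL.
  rewrite QE; apply: le_trans (low_level_term_le c_gt0 n_gt0 od L0 B0 a0 (N0 _) hB _) _.
    (* With [q = L / d], the threshold [d <= L / 2] between low and high levels is exactly the
       requirement [2 <= q]. *)
    have q2 : 2 <= L / d%:R by rewrite ler_pdivlMr//; lra.
    have q0 : 0 < L / d%:R by lra.
    have Vd : level V d (F (Some d)) by exact: (cF (Some d)).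
    have fd : cinner mu f (F (Some d)) = real_complex R (N (Some d) ^+ 2).
      by rewrite (cinner_component Lf cF fF (o := Some d) Vd) cinner_nrm.
    apply: le_trans (level_inequality mA C_gt0 hyp q2 dn Vd fd) _.
    rewrite -/alpha.
    have K0 : 0 <= (Num.max C 1 * Num.sqrt (L / d%:R)) ^+ d.
      by rewrite exprn_ge0// mulr_ge0 ?sqrtr_ge0//; lra.
    apply: le_trans (ler_wpM2r K0 (powR_1B q0 La)) _.
    have -> : L / (L / d%:R) = d%:R * 1 by field; rewrite !gt_eqF.
    by rewrite expRM_natl -mulrA -exprMn [expR 1 * _]mulrA.
  by rewrite lerDl mulr_ge0// sqr_ge0.
have sumB1 : \sum_(o | nontrivial o) B1 o <= alpha ^+ 3 / 3.
  rewrite (bigD1 None)//= add0r (reindex_omap Some id); last by case=> [d|] /andP[].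
  rewrite (eq_bigl (fun d : 'I_(uphalf n) => (0 < d)%N)); last first.
    by move=> d; rewrite /= eqxx !andbT.
  rewrite /= -mulr_sumr ler_pM2l ?exprn_gt0//.
  by apply: le_trans (sum_geometric_le _) _; lra.
have sumB2 : \sum_(o | nontrivial o) E * N o ^+ 2 <= alpha ^+ 3 / 2.
  apply: le_trans _ (high_level_sum_le Lge2 La).
  (* By Parseval the sum of [N o ^+ 2] over all components is [alpha]. *)
  rewrite -/E -[in leRHS]pars mulr_sumr [leRHS](bigID (@nontrivial n))/= lerDl.
  by apply: sumr_ge0 => o _; rewrite mulr_ge0// sqr_ge0.
move=> h.
have h2 : alpha ^+ 3 <= \sum_(o | nontrivial o) (B1 o + E * N o ^+ 2).
  by apply: le_trans h _; apply: ler_sum => o; exact: term.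
rewrite big_split /= in h2.
have a3 : 0 < alpha ^+ 3 by rewrite exprn_gt0.
(* [1/3 + 1/2 < 1], contradicting [alpha ^+ 3 > 0]. *)
lra.
Qed.
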